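(* Let $(X,\mu)$ be a standard probability space and let $\mathcal{G}$ be an ergodic $d$-regular Borel pmp graph on $X$ with spectral gap. If $-d\in\sigma(T_{\mathcal{G}})$, then $\mathcal{G}$ is approximately measurably bipartite.
   Context: A Borel graph on $X$ is a simple undirected graph whose edge set is Borel in $X^2$; it is $d$-regular if every vertex has degree $d$ (up to a null set). $\mathcal{G}$ is pmp if every partial Borel bijection of $X$ whose graph is contained in the connectedness relation of $\mathcal{G}$ preserves $\mu$. $\mathcal{G}$ is ergodic if every measurable set that is a union of connected components of $\mathcal{G}$ has measure $0$ or $1$. The adjacency operator is $(T_{\mathcal{G}}f)(x)=\sum_{y\sim x}f(y)$ on $L^2(X,\mu)$; $\sigma$ denotes spectrum. A $d$-regular $\mathcal{G}$ has spectral gap if there is $\varepsilon>0$ with $\sigma(T_{\mathcal{G}})\subseteq[-d,d-\varepsilon]\cup\{d\}$. $\mathcal{G}$ is approximately measurably bipartite if for every $\varepsilon>0$ there are disjoint measurable sets $A,B$, each containing no two adjacent vertices, with $\mu(A\cup B)>1-\varepsilon$. *)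

(* Defs.v *)
From HB Require Import structures.
From mathcomp Require Import all_boot all_order all_algebra.
From mathcomp Require Import all_classical all_reals all_analysis.
From Stdlib Require Import Relations.
Set Implicit Arguments. Unset Strict Implicit. Unset Printing Implicit Defensive.
Import Order.TTheory GRing.Theory Num.Theory.
Local Open Scope classical_set_scope.
Local Open Scope ring_scope.
Local Open Scope card_scope.

Section Defs.
Context {dX : measure_display} {X : measurableType dX} {R : realType}.

Definition standard_borel : Prop :=
  exists (f : X -> R) (B : set R),
    measurable B /\ measurable_fun setT f /\ set_inj setT f /\ f @` setT = B /\
    (forall S : set X, measurable S -> measurable (f @` S)).

Definition borel_graph (E : set (X * X)) : Prop :=
  measurable E /\ (forall x y, E (x, y) -> E (y, x)) /\ (forall x, ~ E (x, x)).

Definition nbhd (E : set (X * X)) (x : X) : set X := [set y | E (x, y)].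

Definition d_regular (mu : {measure set X -> \bar R}) (E : set (X * X)) (d : nat) : Prop :=
  {ae mu, forall x, nbhd E x #= `I_ d}.

Definition connected_rel (E : set (X * X)) : relation X :=
  clos_refl_trans X (fun x y => E (x, y)).

Definition partial_borel_bijection (A : set X) (phi : X -> X) : Prop :=
  measurable A /\ measurable_fun A phi /\ set_inj A phi /\
  (forall S, measurable S -> S `<=` A -> measurable (phi @` S)).

Definition graph_pmp (mu : {measure set X -> \bar R}) (E : set (X * X)) : Prop :=
  forall (A : set X) (phi : X -> X),
    partial_borel_bijection A phi ->
    (forall x, A x -> connected_rel E x (phi x)) ->
    forall S, measurable S -> S `<=` A -> mu (phi @` S) = mu S.

Definition graph_ergodic (mu : {measure set X -> \bar R}) (E : set (X * X)) : Prop :=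
  forall S : set X, measurable S ->
    (forall x y, S x -> connected_rel E x y -> S y) ->
    mu S = 0%E \/ mu S = 1%E.

(* adjacency operator (T f)(x) = sum_{y ~ x} f y; set to 0 at the (null set of)
   vertices of infinite degree *)
Definition adj_op (E : set (X * X)) (f : X -> R) (x : X) : R :=
  if pselect (finite_set (nbhd E x)) is left _ then \sum_(y \in nbhd E x) f y else 0.

Definition inL2 (mu : {measure set X -> \bar R}) (f : X -> R) : Prop :=
  measurable_fun setT f /\ (\int[mu]_x ((f x) ^+ 2)%:E < +oo)%E.

(* lam lies in the spectrum of T on L^2(mu) iff T - lam I is not a bijection of
   L^2(mu) (functions identified up to mu-a.e. equality); by the open mapping
   theorem, a bijective bounded operator has bounded inverse. *)
Definition in_spectrum (mu : {measure set X -> \bar R})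
    (T : (X -> R) -> (X -> R)) (lam : R) : Prop :=
  ~ ((forall f, inL2 mu f -> {ae mu, forall x, T f x - lam * f x = 0} ->
                {ae mu, forall x, f x = 0}) /\
     (forall g, inL2 mu g -> exists2 f, inL2 mu f &
                {ae mu, forall x, T f x - lam * f x = g x})).

Definition spectral_gap (mu : {measure set X -> \bar R}) (E : set (X * X)) (d : nat) : Prop :=
  exists eps : R, 0 < eps /\
    forall lam, in_spectrum mu (adj_op E) lam ->
      (- d%:R <= lam <= d%:R - eps) \/ lam = d%:R.

Definition independent_set (E : set (X * X)) (A : set X) : Prop :=
  forall x y, A x -> A y -> ~ E (x, y).

Definition approx_measurably_bipartite (mu : {measure set X -> \bar R}) (E : set (X * X)) : Prop :=
  forall eps : R, 0 < eps ->
    exists A B : set X, [/\ measurable A /\ measurable B, A `&` B = set0,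
      independent_set E A, independent_set E B &
      (mu (A `|` B) > (1 - eps)%:E)%E].

End Defs.

(* Main.v *)
(** Since [-d] lies in the spectrum of the adjacency operator [T], the operator
    [T + d >= 0] is not coercive, so there are unit vectors [f] with
    [<(T + d) f, f> = 1/2 \int sum_(y ~ x) (f x + f y)^2] arbitrarily small.  Then
    [<(d - T) |f|, |f|>] is at most as large.  Because the spectrum of [d - T]
    misses an interval [(0, eps)], the energy [<(d - T) h, h>] controls the square
    of the distance from [h] to the kernel of [d - T], which by ergodicity consists
    of constants.  So [|f|] is close to a constant, and the sets where [f] is
    clearly positive, respectively clearly negative, become independent after
    the few vertices with a neighbour on the same side are removed.

    Measurability of [T f] and the identities above come from measurable neighbour
    functions [phi_1, ..., phi_d]: a measurable subset of [X * R] is a Souslin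
    set, and Choquet's capacitability argument applied to the tree of a Souslin
    scheme yields a measurable selector on a set of almost full measure.  That
    almost every vertex has its whole component in a given conull set follows
    from [d + 1] not being an eigenvalue of [T]. *)
Require Import Defs.
From HB Require Import structures.
From mathcomp Require Import all_boot all_order all_algebra.
From mathcomp Require Import all_classical all_reals all_analysis.
From mathcomp Require Import measurable_realfun.
From mathcomp Require Import ring lra zify.
From Stdlib Require Cantor Relations.
Set Implicit Arguments. Unset Strict Implicit. Unset Printing Implicit Defensive.
Import Order.TTheory GRing.Theory Num.Theory.
Import numFieldNormedType.Exports.
Local Open Scope classical_set_scope.
Local Open Scope ring_scope.
Local Open Scope card_scope.

(** * Symmetric operators on a complete semi-inner product space *)

(** [in_spectrum] speaks only of bijectivity of [T - lam] on functions modulo null sets, so every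
    spectral fact enters and leaves as injectivity or surjectivity. Spectral projections are
    replaced by iterations, and with [D = d - T] the gap becomes the operator inequality
    [D ^+ 2 >= eps D], obtained by minimising a quadratic form. A second obstacle is a threatening
    circle. That [T] acts on [L2], boundedly and symmetrically, rests on mass transport, and mass
    transport needs a conull set [Y] mapped into itself by the neighbour functions. Such a [Y] must
    therefore be found before any norm bound on [T] is known. The gap hypothesis itself provides it:
    [d + 1] exceeds [d - eps] and differs from [d], hence is outside the spectrum, and by definition
    this already gives injectivity of [adj_op - (d + 1)], understood pointwise almost everywhere. *)

Lemma le_geometric_le0 (R : realType) (x K q : R) :
  0 <= q < 1 -> (forall n, x <= K * q ^+ n) -> x <= 0.
Proof.
move=> /andP[q0 q1] h.
have c : (fun n => K * q ^+ n) @ \oo --> (0 : R).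
  by rewrite -(mulr0 K); apply: cvgMr; apply: cvg_expr; rewrite ger0_norm.
by rewrite -(cvg_lim _ c)//; apply: limr_ge; [exact: cvgP c|exact: nearW].
Qed.

Section SemiInner.
Variables (R : realType) (V : lmodType R).

(** Definiteness is not imposed: the vectors will be functions rather than classes, and equality
    almost everywhere will be distance zero. *)
Record semi_inner (b : V -> V -> R) := SemiInner {
  siDl : forall u v w, b (u + v) w = b u w + b v w;
  siZl : forall a u v, b (a *: u) v = a * b u v;
  siC : forall u v, b u v = b v u;
  si_ge0 : forall u, 0 <= b u u }.

Variables (b : V -> V -> R) (H : semi_inner b).

Lemma siDr u v w : b u (v + w) = b u v + b u w.
Proof. by rewrite siC// siDl// !(siC H u). Qed.
Lemma siZr a u v : b u (a *: v) = a * b u v.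
Proof. by rewrite siC// siZl// siC. Qed.
Lemma siNl u v : b (- u) v = - b u v.
Proof. by rewrite -scaleN1r siZl// mulN1r. Qed.
Lemma siNr u v : b u (- v) = - b u v.
Proof. by rewrite -scaleN1r siZr mulN1r. Qed.
Lemma si0l v : b 0 v = 0.
Proof. by rewrite -(scale0r 0) siZl// mul0r. Qed.

Definition siE := (siDl H, siDr, siNl, siNr, siZl H, siZr).

Lemma si_cauchy_schwarz u v : b u v ^+ 2 <= b u u * b v v.
Proof.
have key t : 0 <= b u u + 2 * t * b u v + t ^+ 2 * b v v.
  have := si_ge0 H (u + t *: v); rewrite !siE (siC H v u).
  by congr (_ <= _); ring.
have := si_ge0 H v; rewrite le_eqVlt => /predU1P[v0|v0].
  rewrite -v0 mulr0.
  have [->|n0] := eqVneq (b u v) 0; first by rewrite expr0n.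
  (* When [b v v = 0] the expression in [key] is affine in [t], and this [t] gives it the value
     -1. *)
  have := key (- (b u u + 1) / (2 * b u v)); rewrite -v0 mulr0 addr0.
  have -> : 2 * (- (b u u + 1) / (2 * b u v)) * b u v = - (b u u + 1) by field.
  by move=> ?; exfalso; lra.
have := key (- b u v / b v v).
have -> : b u u + 2 * (- b u v / b v v) * b u v + (- b u v / b v v) ^+ 2 * b v v
   = (b u u * b v v - b u v ^+ 2) / b v v by field; rewrite gt_eqF.
by rewrite pmulr_lge0 ?invr_gt0// subr_ge0.
Qed.

End SemiInner.

Section Operators.
Variables (R : realType) (V : lmodType R) (b : V -> V -> R) (H : semi_inner b).
Let siE := siE H.

Definition sn u := Num.sqrt (b u u).

Lemma sn_ge0 u : 0 <= sn u. Proof. exact: sqrtr_ge0. Qed.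
Lemma sn_sqr u : sn u ^+ 2 = b u u. Proof. by rewrite sqr_sqrtr// si_ge0. Qed.

Lemma abs_si_le u v : `|b u v| <= sn u * sn v.
Proof.
rewrite -(@ler_pXn2r _ 2)// ?nnegrE ?mulr_ge0 ?sn_ge0//.
by rewrite real_normK ?num_real// exprMn !sn_sqr si_cauchy_schwarz.
Qed.

Lemma snD u v : sn (u + v) <= sn u + sn v.
Proof.
rewrite -(@ler_pXn2r _ 2)// ?nnegrE ?addr_ge0 ?sn_ge0//.
rewrite sn_sqr !siE (siC H v u) sqrrD !sn_sqr.
have := abs_si_le u v; have := ler_norm (b u v); lra.
Qed.

Lemma snZ a u : sn (a *: u) = `|a| * sn u.
Proof. by rewrite /sn !siE mulrA -expr2 sqrtrM ?sqr_ge0// sqrtr_sqr. Qed.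

Lemma snN u : sn (- u) = sn u.
Proof. by rewrite -scaleN1r snZ normrN1 mul1r. Qed.

Lemma snB u v : sn (u - v) = sn (v - u).
Proof. by rewrite -snN opprB. Qed.

Lemma sn_le_sum u v w : sn (u - w) <= sn (u - v) + sn (v - w).
Proof. by have := snD (u - v) (v - w); rewrite addrA subrK. Qed.

(** Geometric increments suffice, with the rate kept in the conclusion: every limit below comes from
    a contraction iteration or from a series of ratio 1/3. *)
Definition geometrically_complete := forall (u : nat -> V) C q, 0 <= q < 1 ->
  (forall n, sn (u n.+1 - u n) <= C * q ^+ n) ->
  exists l, forall n, sn (u n - l) <= C * q ^+ n / (1 - q).

Record sym_bounded (P : V -> V) := SymBounded {
  sbD : forall u v, P (u + v) = P u + P v;
  sbZ : forall a u, P (a *: u) = a *: P u;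
  sb_sym : forall u v, b (P u) v = b u (P v);
  sb_bounded : exists2 C, 0 <= C & forall u, sn (P u) <= C * sn u }.

Definition surjective_mod (P : V -> V) := forall g, exists f, sn (P f - g) = 0.

Lemma sbN P u : sym_bounded P -> P (- u) = - P u.
Proof. by move=> h; rewrite -scaleN1r sbZ// scaleN1r. Qed.

Lemma sbB P u v : sym_bounded P -> P (u - v) = P u - P v.
Proof. by move=> h; rewrite sbD// sbN. Qed.

Lemma sym_bounded_shift P a : sym_bounded P -> sym_bounded (fun u => P u - a *: u).
Proof.
move=> h; split.
- by move=> u v; rewrite (sbD h) scalerDr opprD addrACA.
- by move=> c u; rewrite (sbZ h) scalerBr !scalerA [c * a]mulrC.
- by move=> u v; rewrite !siE (sb_sym h).
- have [C C0 hC] := sb_bounded h.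
  exists (C + `|a|) => [|u]; first by rewrite addr_ge0.
  rewrite (le_trans (snD _ _))// snN snZ mulrDl lerD//.
Qed.

Lemma sym_boundedN P : sym_bounded P -> sym_bounded (fun u => - P u).
Proof.
move=> h; split.
- by move=> u v; rewrite (sbD h) opprD.
- by move=> c u; rewrite (sbZ h) scalerN.
- by move=> u v; rewrite !siE (sb_sym h).
- by have [C C0 hC] := sb_bounded h; exists C => // u; rewrite snN.
Qed.

Lemma sym_bounded_comp P Q : sym_bounded P -> sym_bounded Q ->
  (forall u, P (Q u) = Q (P u)) -> sym_bounded (fun u => P (Q u)).
Proof.
move=> hP hQ PQ; split.
- by move=> u v; rewrite !sbD.
- by move=> c u; rewrite !sbZ.
- by move=> u v; rewrite !sb_sym// PQ.
- have [C C0 hC] := sb_bounded hP; have [D D0 hD] := sb_bounded hQ.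
  exists (C * D) => [|u]; first by rewrite mulr_ge0.
  by rewrite (le_trans (hC _))// -mulrA ler_wpM2l.
Qed.

Lemma surjective_mod_comp P Q : sym_bounded P ->
  surjective_mod P -> surjective_mod Q -> surjective_mod (fun u => P (Q u)).
Proof.
move=> hP sP sQ g; have [f fg] := sP g; have [e ef] := sQ f.
exists e; apply/eqP; rewrite eq_le sn_ge0 andbT.
rewrite (le_trans (sn_le_sum _ (P f) _))// fg addr0 -sbB//.
by have [C C0 hC] := sb_bounded hP; rewrite (le_trans (hC _))// ef mulr0.
Qed.

(* Cauchy-Schwarz for the form [<P u, v>], applied to [u] and [P u]. *)
Lemma psd_sqr_le P C u : sym_bounded P -> (forall v, 0 <= b (P v) v) ->
  (forall v, b (P v) v <= C * b v v) -> b (P u) (P u) <= C * b (P u) u.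
Proof.
move=> hP P0 PC.
have hb : semi_inner (fun v w => b (P v) w).
  split=> [v w z|a v w|v w|v]; rewrite ?sbD// ?sbZ// ?siE//.
  by rewrite sb_sym// siC.
have := si_ge0 H (P u); rewrite le_eqVlt => /predU1P[p0|p0].
  rewrite -p0; apply: contrapT => /negP; rewrite -ltNge => h.
  have := si_cauchy_schwarz hb u u; have := si_cauchy_schwarz H (P u) u.
  rewrite -p0 mul0r => h1 _.
  have : b (P u) u = 0 by apply/eqP; rewrite -sqrf_eq0 eq_le h1 sqr_ge0.
  by move=> h2; rewrite h2 mulr0 ltxx in h.
have := si_cauchy_schwarz hb u (P u) => /= cs.
rewrite -(ler_pM2r p0) -expr2 (le_trans cs)//.
by rewrite mulrAC [leRHS]mulrC ler_wpM2l.
Qed.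

Lemma sn_eq0_le u v K q : 0 <= q < 1 ->
  (forall n, sn (u - v) <= K * q ^+ n) -> sn (u - v) = 0.
Proof.
move=> q01 h; apply/eqP; rewrite eq_le sn_ge0 andbT.
exact: le_geometric_le0 q01 h.
Qed.

Hypothesis complete : geometrically_complete.

(* The Richardson iteration [u_(n+1) = u_n + (g - P u_n) / C]. *)
Lemma coercive_surjective P c C : sym_bounded P -> 0 < c -> 0 < C ->
  (forall u, c * b u u <= b (P u) u) -> (forall u, b (P u) u <= C * b u u) ->
  surjective_mod P.
Proof.
(* Shrinking [c] to at most [C] keeps [1 - c / C] nonnegative, so that its square root can serve as
   the contraction factor. *)
move=> hP; wlog cC : c / c <= C => [hwlog|] c0 C0 cP PC g.
  apply: (hwlog (Num.min c C)) => //; first by rewrite ge_min lexx orbT.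
    by rewrite lt_min c0.
  by move=> u; rewrite (le_trans _ (cP u))// ler_wpM2r ?si_ge0// ge_min lexx.
pose u := fix u n := if n is m.+1 then u m + C^-1 *: (g - P (u m)) else 0.
pose r n := g - P (u n).
have rS n : r n.+1 = r n - C^-1 *: P (r n).
  by rewrite {1}/r /= (sbD hP) (sbZ hP) opprD addrA.
pose q := Num.sqrt (1 - c / C).
have cC1 : 0 < c / C <= 1 by rewrite divr_gt0//= ler_pdivrMr// mul1r.
have q01 : 0 <= q < 1.
  rewrite sqrtr_ge0/= -(@ltr_pXn2r _ 2)// ?nnegrE ?sqrtr_ge0// sqr_sqrtr ?expr1n; lra.
(* Since [|P r| ^+ 2 <= C * <P r, r>], one has [|r - P r / C| ^+ 2 <= |r| ^+ 2 - <P r, r> / C <= (1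
   - c / C) * |r| ^+ 2]. *)
have rle n : sn (r n) <= sn (r 0) * q ^+ n.
  elim: n => [|n IH]; first by rewrite expr0 mulr1.
  rewrite exprS mulrCA; apply: (@le_trans _ _ (q * sn (r n))); last first.
    by apply: ler_wpM2l => //; case/andP: q01.
  rewrite -(@ler_pXn2r _ 2)// ?nnegrE ?mulr_ge0 ?sn_ge0//; last by case/andP: q01.
  rewrite exprMn !sn_sqr sqr_sqrtr; last lra.
  rewrite rS; move: (r n) => w; rewrite !siE (siC H w (P w)).
  have psd v : 0 <= b (P v) v.
    by rewrite (le_trans _ (cP v))// mulr_ge0 ?(si_ge0 H)// ltW.
  have := psd_sqr_le w hP psd PC; have := cP w.
  set x := b (P w) w; set y := b (P _) (P _); set z := b _ _ => h1 h2.
  have : C^-1 * (C^-1 * y) <= C^-1 * x.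
    by rewrite ler_pM2l ?invr_gt0// ler_pdivrMl.
  have : C^-1 * (c * z) <= C^-1 * x by rewrite ler_pM2l ?invr_gt0.
  have -> : (1 - c / C) * z = z - C^-1 * (c * z) by ring.
  lra.
have [n|l hl] := complete (u := u) (C := C^-1 * sn (r 0)) q01.
  rewrite /= addrC addKr snZ gtr0_norm ?invr_gt0// -mulrA.
  by rewrite ler_pM2l ?invr_gt0//; exact: rle.
exists l; rewrite snB; have [D D0 hD] := sb_bounded hP.
apply: (@sn_eq0_le _ _ (sn (r 0) + D * (C^-1 * sn (r 0) / (1 - q))) q q01) => n.
rewrite (le_trans (sn_le_sum _ (P (u n)) _))// mulrDl lerD//; first exact: rle.
rewrite -(sbB _ _ hP) (le_trans (hD _))// -mulrA ler_wpM2l//.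
by rewrite (le_trans (hl n))// mulrAC.
Qed.

(* A gliding hump: if [P] is not bounded below on unit vectors [k_n], then a
   suitable [g = \sum_n (+-) 3^-n k_n] is not in the range, because
   [<P f, k_n> = <f, P k_n>] decays faster than [3^-n]. *)
Lemma surjective_bounded_below P : sym_bounded P -> surjective_mod P ->
  exists2 c, 0 < c & forall u, c * sn u <= sn (P u).
Proof.
move=> hP sP; apply: contrapT => nb.
have hk n : exists k, sn k = 1 /\ sn (P k) <= (4^-1 : R) ^+ n.
  apply: contrapT => nk; apply: nb; exists (4^-1 ^+ n) => [|u].
    by rewrite exprn_gt0// invr_gt0.
  have [u0|u0] := eqVneq (sn u) 0; first by rewrite u0 mulr0 sn_ge0.
  have up : 0 < sn u by rewrite lt_def u0 sn_ge0.
  rewrite leNgt; apply/negP => h; apply: nk; exists ((sn u)^-1 *: u); split.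
    by rewrite snZ ger0_norm ?invr_ge0 ?sn_ge0// mulVf.
  rewrite (sbZ hP) snZ ger0_norm ?invr_ge0 ?sn_ge0//.
  by rewrite mulrC ler_pdivrMr// ltW.
have [k kP] := choice hk.
(* The sign makes the new term reinforce [b (g n) (k n)], so that the two cannot cancel. *)
pose s (g : V) n : R := if 0 <= b g (k n) then 1 else -1.
pose g := fix g n := if n is m.+1 then g m + (3^-1 ^+ m * s (g m) m) *: k m else 0.
have p3 n : 0 < (3^-1 : R) ^+ n by rewrite exprn_gt0// invr_gt0.
have gk n : 3^-1 ^+ n <= `|b (g n.+1) (k n)|.
  have kk : b (k n) (k n) = 1 by rewrite -sn_sqr (kP n).1 expr1n.
  rewrite /= !siE kk mulr1 /s; have pn := p3 n; case: ifPn => [h|].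
    rewrite mulr1 ger0_norm; lra.
  rewrite -ltNge mulrN1 => h; rewrite ltr0_norm; lra.
have q01 : 0 <= (3^-1 : R) < 1 by lra.
have [n|l hl] := complete (u := g) (C := 1) q01.
  rewrite /= addrC addKr snZ (kP n).1 mulr1 mul1r normrM gtr0_norm//.
  by rewrite /s; case: ifP => _; rewrite ?normrN normr1 mulr1.
have [f Pf] := sP l.
have lk n : b l (k n) = b f (P (k n)).
  rewrite -(sb_sym hP); apply/eqP; rewrite -subr_eq0 -normr_eq0 -siNl// -siDl//.
  by rewrite eq_le normr_ge0 andbT (le_trans (abs_si_le _ _))// snB Pf mul0r.
(* The terms after the [n]-th change the pairing with [k n] by at most [3^-1 ^+ n / 2], so
   [|b l (k n)|] keeps at least that much, while it is at most [sn f * 4^-1 ^+ n]. *)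
have key n : 1 <= (2 * sn f) * (3 / 4) ^+ n.
  have h1 := gk n.
  have h2 : `|b (g n.+1 - l) (k n)| <= 3^-1 ^+ n / 2.
    rewrite (le_trans (abs_si_le _ _))// (kP n).1 mulr1 (le_trans (hl _))//.
    have -> : (1 - 3^-1 : R) = 2 / 3 by field.
    by rewrite exprS; move: (_ ^+ n) => t; have -> : 1 * (3^-1 * t) / (2 / 3) = t / 2 by field.
  have h3 : `|b l (k n)| <= sn f * 4^-1 ^+ n.
    by rewrite lk (le_trans (abs_si_le _ _))// ler_wpM2l ?sn_ge0// (kP n).2.
  have h4 : `|b (g n.+1) (k n)| <= `|b (g n.+1 - l) (k n)| + `|b l (k n)|.
    by rewrite (le_trans _ (ler_normD _ _))// !siE subrK.
  have h5 : 3^-1 ^+ n <= 2 * sn f * 4^-1 ^+ n by rewrite -mulrA; lra.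
  have -> : (3 / 4 : R) ^+ n = (3^-1 ^+ n)^-1 * 4^-1 ^+ n.
    by rewrite exprMn exprVn invrK.
  by rewrite mulrCA -ler_pdivrMl ?invr_gt0// invrK mulr1.
have : (1 : R) <= 0 by apply: (@le_geometric_le0 _ _ _ (3 / 4)) key; lra.
by rewrite ler10.
Qed.

(* If [m = s ^+ 2 < a ^+ 2] is the infimum of the numerical range of
   [(D - a) ^+ 2], then [(D - a) ^+ 2 - m = (D - a - s) (D - a + s)] is
   surjective and positive, hence coercive, contradicting minimality. *)
Lemma gap_sqr_ge D C eps : sym_bounded D -> 0 < eps ->
  (forall u, 0 <= b (D u) u) -> (forall u, b (D u) u <= C * b u u) ->
  (forall lam, 0 < lam < eps -> surjective_mod (fun u => D u - lam *: u)) ->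
  forall u, eps * b (D u) u <= b (D u) (D u).
Proof.
move=> hD e0 D0 DC sD.
pose a := eps / 2; pose A u := D u - a *: u.
have hA : sym_bounded A by exact: sym_bounded_shift.
(* As [eps = 2 * a], the operator [D ^+ 2 - eps D] equals [(D - a) ^+ 2 - a ^+ 2]. *)
suff key u : a ^+ 2 * b u u <= b (A u) (A u).
  move=> u; have := key u; rewrite /A !siE (siC H u (D u)).
  have -> : eps = 2 * a by rewrite /a; lra.
  set x := b (D u) u; set y := b (D u) (D u); set z := b u u; lra.
have [u0|u0] := eqVneq (b u u) 0; first by rewrite u0 mulr0 si_ge0.
pose S := [set x | exists2 v, b v v = 1 & x = b (A v) (A v)].
have norm1 v : b v v != 0 -> b ((sn v)^-1 *: v) ((sn v)^-1 *: v) = 1.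
  move=> v0; rewrite !siE mulrA -expr2 exprVn sn_sqr mulVf//.
have S0 : S !=set0.
  by exists (b (A ((sn u)^-1 *: u)) (A ((sn u)^-1 *: u))), ((sn u)^-1 *: u); rewrite ?norm1.
have lS : lbound S 0 by move=> _ [v _ ->]; exact: si_ge0.
have hS : has_inf S by split => //; exists 0.
pose m := inf S.
have m0 : 0 <= m by exact: lb_le_inf.
have Am v : m * b v v <= b (A v) (A v).
  have [v0|v0] := eqVneq (b v v) 0; first by rewrite v0 mulr0 si_ge0.
  have : m <= b (A ((sn v)^-1 *: v)) (A ((sn v)^-1 *: v)).
    by apply: ge_inf; [exists 0|exists ((sn v)^-1 *: v); rewrite ?norm1].
  rewrite (sbZ hA) !siE mulrA -expr2 exprVn sn_sqr.
  by rewrite ler_pdivlMl ?lt_def ?v0 ?si_ge0// mulrC.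
have [ma|ma] := leP (a ^+ 2) m.
  by rewrite (le_trans _ (Am u))// ler_wpM2r ?si_ge0.
exfalso; pose s := Num.sqrt m.
have sm : s ^+ 2 = m by rewrite sqr_sqrtr.
have sa : 0 <= s < a.
  rewrite sqrtr_ge0/= -(@ltr_pXn2r _ 2)// ?nnegrE ?sqrtr_ge0 ?sm// /a; lra.
pose A1 v := D v - (a + s) *: v; pose A2 v := D v - (a - s) *: v.
have h1 : sym_bounded A1 by exact: sym_bounded_shift.
have h2 : sym_bounded A2 by exact: sym_bounded_shift.
have comm v : A1 (A2 v) = A2 (A1 v).
  rewrite /A1 /A2 !(sbB _ _ hD) !(sbZ hD) !scalerBr !scalerA.
  have swap (x y z t : V) : x - y - (z - t) = x - z - (y - t).
    by rewrite !opprB !addrA addrAC [x - y - z]addrAC addrAC.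
  by rewrite swap [(a + s) * _]mulrC.
pose B v := A1 (A2 v).
have hB : sym_bounded B by exact: sym_bounded_comp.
(* [0 <= s < a] puts both [a + s] and [a - s] strictly between 0 and [eps]. *)
have sB : surjective_mod B.
  by apply: surjective_mod_comp => //; apply: sD; rewrite /a in sa *; lra.
have Bv v : b (B v) v = b (A v) (A v) - m * b v v.
  rewrite /B (sb_sym h1) /A /A1 /A2 -sm !siE (siC H v (D v)); ring.
have [c c0 cB] := surjective_bounded_below hB sB.
have B0 v : 0 <= b (B v) v by rewrite Bv subr_ge0.
have [K K0 hK] : exists2 K, 0 < K & forall v, b (B v) v <= K * b v v.
  have [K K0 hK] := sb_bounded hB; exists (K + 1) => [|v]; first lra.
  rewrite (le_trans (ler_norm _))// (le_trans (abs_si_le _ _))//.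
  rewrite -sn_sqr expr2 mulrA ler_wpM2r ?sn_ge0// (le_trans (hK _))//.
  by rewrite ler_wpM2r ?sn_ge0//; lra.
(* A lower bound on norms becomes coercivity through [c ^+ 2 * |v| ^+ 2 <= |B v| ^+ 2 <= K * <B v,
   v>], the second inequality using positivity of [B]. *)
have cB2 v : c ^+ 2 / K * b v v <= b (B v) v.
  rewrite mulrAC ler_pdivrMr// [leRHS]mulrC.
  rewrite (le_trans _ (psd_sqr_le v hB B0 hK))// -!sn_sqr -exprMn.
  by rewrite ler_pXn2r ?nnegrE ?mulr_ge0 ?sn_ge0// ltW.
have : m + c ^+ 2 / K <= m.
  apply: lb_le_inf => // _ [v v1 ->].
  by have := cB2 v; rewrite Bv v1 !mulr1; lra.
have : 0 < c ^+ 2 / K by rewrite divr_gt0// exprn_gt0.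
lra.
Qed.

(* Under the heat flow [u_(n+1) = u_n - D u_n / C] the energy [<D u_n, u_n>]
   decays geometrically. *)
Lemma gap_projection D C eps : sym_bounded D -> 0 < eps -> 0 < C ->
  (forall u, 0 <= b (D u) u) -> (forall u, b (D u) u <= C * b u u) ->
  (forall u, eps * b (D u) u <= b (D u) (D u)) ->
  exists2 K, 0 < K & forall u, exists2 l, sn (D l) = 0 &
    sn (u - l) <= K * Num.sqrt (b (D u) u).
Proof.
move=> hD; wlog eC : eps / eps <= C => [hwlog|] e0 C0 D0 DC De.
  apply: (hwlog (Num.min eps C)) => //; first by rewrite ge_min lexx orbT.
    by rewrite lt_min e0.
  by move=> u; rewrite (le_trans _ (De u))// ler_wpM2r ?D0// ge_min lexx.
pose q := Num.sqrt (1 - eps / C).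
have eC1 : 0 < eps / C <= 1 by rewrite divr_gt0//= ler_pdivrMr// mul1r.
have q01 : 0 <= q < 1.
  rewrite sqrtr_ge0/= -(@ltr_pXn2r _ 2)// ?nnegrE ?sqrtr_ge0// sqr_sqrtr ?expr1n; lra.
pose N v := Num.sqrt (b (D v) v).
have DN v : sn (D v) <= Num.sqrt C * N v.
  rewrite -(@ler_pXn2r _ 2)// ?nnegrE ?mulr_ge0 ?sn_ge0 ?sqrtr_ge0//.
  by rewrite exprMn sn_sqr !sqr_sqrtr ?psd_sqr_le// ltW.
exists (C^-1 * Num.sqrt C / (1 - q)) => [|v].
  by rewrite divr_gt0 ?mulr_gt0 ?invr_gt0 ?sqrtr_gt0//; lra.
pose u := fix u n := if n is m.+1 then u m - C^-1 *: D (u m) else v.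
(* One step turns [<D w, w>] into [<D w, w> - 2 |D w| ^+ 2 / C + <D (D w), D w> / C ^+ 2], which is
   at most [<D w, w> - |D w| ^+ 2 / C]; the gap inequality bounds this by
   [(1 - eps / C) * <D w, w>]. *)
have Nle n : N (u n) <= N v * q ^+ n.
  elim: n => [|n IH]; first by rewrite expr0 mulr1.
  rewrite exprS mulrCA; apply: (@le_trans _ _ (q * N (u n))); last first.
    by apply: ler_wpM2l => //; case/andP: q01.
  rewrite -(@ler_pXn2r _ 2)// ?nnegrE ?mulr_ge0 ?sqrtr_ge0//.
  rewrite exprMn !sqr_sqrtr ?D0//; last lra.
  rewrite /=; move: (u n) => w; rewrite (sbB _ _ hD) (sbZ hD) !siE (sb_sym hD (D w) w).
  have := DC (D w); have := De w.
  set x := b (D w) w; set y := b (D w) (D w); set z := b _ _ => h1 h2.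
  have : C^-1 * (C^-1 * z) <= C^-1 * y.
    by rewrite ler_pM2l ?invr_gt0// ler_pdivrMl.
  have : C^-1 * (eps * x) <= C^-1 * y by rewrite ler_pM2l ?invr_gt0.
  have -> : (1 - eps / C) * x = x - C^-1 * (eps * x) by ring.
  lra.
have Dle n : sn (D (u n)) <= Num.sqrt C * N v * q ^+ n.
  by rewrite (le_trans (DN _))// -mulrA ler_wpM2l ?sqrtr_ge0.
have [n|l hl] := complete (u := u) (C := C^-1 * (Num.sqrt C * N v)) q01.
  rewrite /= addrC addKr snN snZ gtr0_norm ?invr_gt0// -mulrA.
  by rewrite ler_pM2l ?invr_gt0//; exact: Dle.
exists l; last first.
  have := hl 0; rewrite /= expr0 mulr1 => h; rewrite (le_trans h)//.
  by rewrite -/(N v) !mulrA [leRHS]mulrAC.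
have [E E0 hE] := sb_bounded hD.
have : sn (D l - 0) = 0.
  apply: (@sn_eq0_le _ _ (Num.sqrt C * N v + E * (C^-1 * (Num.sqrt C * N v) / (1 - q))) q q01) => n.
  rewrite (le_trans (sn_le_sum _ (D (u n)) _))// mulrDl addrC lerD//; first by rewrite subr0; exact: Dle.
  rewrite -(sbB _ _ hD) (le_trans (hE _))// -mulrA ler_wpM2l// snB.
  by rewrite (le_trans (hl n))// mulrAC.
by rewrite subr0.
Qed.

End Operators.

(** * Measurable selection *)

Lemma countType_bigcup_measurable d (T : measurableType d) (I : countType)
    (P : set I) (F : I -> set T) :
  (forall i, P i -> measurable (F i)) -> measurable (\bigcup_(i in P) F i).
Proof.
move=> mF; rewrite bigcup_mkcond; apply: countable_bigcupT_measurable => [|i].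
  exact: countableP.
by case: ifPn => // /set_mem; exact: mF.
Qed.

Lemma measurable_prop d (T : measurableType d) (P : Prop) :
  measurable [set _ : T | P].
Proof.
have [p|p] := pselect P.
  by rewrite (_ : [set _ | _] = setT)//; apply/seteqP; split.
by rewrite (_ : [set _ | _] = set0)//; apply/seteqP; split.
Qed.

(** * Souslin schemes over rectangles with a compact side *)

Section Souslin.
Context d (X : measurableType d) (R : realType).
Implicit Types (M : R) (F : set (X * R)).

(** The second side is a closed interval so that, by compactness, compatible cells along a branch
    share an ordinate; projecting to [X] then leaves a condition on the first sides only. *)
Definition in_cell (c : set X * (R * R)) (z : X * R) :=
  c.1 z.1 /\ c.2.1 <= z.2 <= c.2.2.

(* Points with [M < `|y|] are ignored, so that [setT `*` `[- M, M]] serves as a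
   trivial cell. *)
Definition souslin M F := exists P : seq nat -> set X * (R * R),
  (forall w, measurable (P w).1) /\
  forall z, `|z.2| <= M -> F z <-> exists s, forall n, in_cell (P (mkseq s n)) z.

Lemma mkseqS_cons (s : nat -> nat) n :
  mkseq s n.+1 = s 0 :: mkseq (fun i => s i.+1) n.
Proof. by rewrite /mkseq /= -[1%N]addn0 iotaDl -map_comp. Qed.

(** The first entry of a branch selects [k] and the remaining entries form a branch for [F k]; the
    root carries the trivial cell. *)
Lemma souslin_bigcup M (F : nat -> set (X * R)) :
  (forall k, souslin M (F k)) -> souslin M (\bigcup_k F k).
Proof.
move=> /choice[P hP].
exists (fun w => if w is k :: v then P k v else (setT, (- M, M))); split.
  by case=> [|k v] //=; exact: (hP k).1.
move=> z zM; split.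
- move=> [k _ /((hP k).2 _ zM)[s hs]].
  exists (fun i => if i is j.+1 then s j else k) => -[|n].
    by split => //=; rewrite -ler_norml.
  by rewrite mkseqS_cons; exact: hs.
- move=> [s hs]; exists (s 0) => //; apply/((hP _).2 _ zM).
  by exists (fun i => s i.+1) => n; have := hs n.+1; rewrite mkseqS_cons.
Qed.

Lemma Cantor_to_nat_mono k i n : (i < n)%N ->
  (Cantor.to_nat (k, i) < Cantor.to_nat (k, n))%N.
Proof.
by move=> ?; have := Cantor.to_nat_spec k i; have := Cantor.to_nat_spec k n; nia.
Qed.

(** One branch codes a sequence of branches by Cantor pairing. A node of length
    [Cantor.to_nat (k, n)] carries the [n]-th condition of the [k]-th branch; the entries this
    involves are already present, because the pairing increases with its second argument. *)
Lemma souslin_bigcap M (F : nat -> set (X * R)) :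
  (forall k, souslin M (F k)) -> souslin M (\bigcap_k F k).
Proof.
move=> /choice[P hP].
pose Q w := let: (k, n) := Cantor.of_nat (size w) in
  P k (mkseq (fun i => nth 0 w (Cantor.to_nat (k, i))) n).
have QE (s : nat -> nat) k n : Q (mkseq s (Cantor.to_nat (k, n))) =
    P k (mkseq (fun i => s (Cantor.to_nat (k, i))) n).
  rewrite /Q size_mkseq Cantor.cancel_of_to; congr (P k _).
  apply/eq_in_map => i; rewrite mem_iota add0n => /andP[_ lin].
  by rewrite nth_mkseq// Cantor_to_nat_mono.
exists Q; split.
  by move=> w; rewrite /Q; case: Cantor.of_nat => k n; exact: (hP k).1.
move=> z zM; split.
- move=> Fz.
  have /choice[s hs] k : exists s, forall n, in_cell (P k (mkseq s n)) z.
    exact/((hP k).2 _ zM)/Fz.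
  exists (fun m => let: (k, i) := Cantor.of_nat m in s k i) => m.
  rewrite -(Cantor.cancel_to_of m); case: (Cantor.of_nat m) => k n.
  rewrite QE; have := hs k n; congr (in_cell (P k _) z).
  by apply/eq_map => i; rewrite Cantor.cancel_of_to.
- move=> [s hs] k _; apply/((hP k).2 _ zM).
  by exists (fun i => s (Cantor.to_nat (k, i))) => n; rewrite -QE; exact: hs.
Qed.

Lemma souslin_rect M (A : set X) (a b : R) : measurable A ->
  souslin M (A `*` `[a, b]).
Proof.
move=> mA; exists (fun=> (A, (a, b))); split => // z _.
rewrite /in_cell /=; split; first by move=> [? /[!in_itv]]; exists id.
by move=> [s /(_ 0)] [? ?]; split => //=; rewrite in_itv.
Qed.

Lemma souslin_ext M F G : (forall z, `|z.2| <= M -> F z <-> G z) ->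
  souslin M F -> souslin M G.
Proof.
move=> FG [P [mP hP]]; exists P; split => // z zM.
by rewrite -FG//; exact: hP.
Qed.

Lemma souslinU M F G : souslin M F -> souslin M G -> souslin M (F `|` G).
Proof.
move=> sF sG; rewrite -bigcup2E; apply: souslin_bigcup => -[|[|k]] //=.
by have := souslin_rect M 0 0 measurable0; rewrite set0X.
Qed.

Lemma souslinI M F G : souslin M F -> souslin M G -> souslin M (F `&` G).
Proof.
move=> sF sG; rewrite -bigcap2E; apply: souslin_bigcap => -[|[|k]] //=.
apply: souslin_ext (souslin_rect M (- M) M measurableT) => -[x y] /= yM.
by split => // _; split => //; rewrite /= in_itv/= -ler_norml.
Qed.

(** Souslin sets need not be stable under complement, so the induction runs over the sets that are
    Souslin together with their complement; these form a sigma-algebra containing the rectangles. *)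
Lemma measurable_souslin M F : measurable F -> souslin M F.
Proof.
pose S := [set F | souslin M F /\ souslin M (~` F)].
suff : (measurable : set (set (X * R))) `<=` S by move=> + mF => /(_ _ mF)[].
have cylA (A : set X) : measurable A -> souslin M (A `*` setT).
  move=> mA; apply: souslin_ext (souslin_rect M (- M) M mA) => -[x y] /= yM.
  by split=> [][] //= ? _; split => //=; rewrite in_itv/= -ler_norml.
have S0 : S set0.
  by split; rewrite ?setC0; [rewrite -(set0X setT)|rewrite -setXTT]; exact: cylA.
have SC G : S G -> S (~` G) by move=> [? ?]; split => //; rewrite setCK.
have SU (G : nat -> set (X * R)) : (forall k, S (G k)) -> S (\bigcup_k G k).
  move=> SG; split; first by apply: souslin_bigcup => k; have [] := SG k.
  by rewrite setC_bigcup; apply: souslin_bigcap => k; have [] := SG k.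
have cylB (B : set R) : measurable B -> S (setT `*` B).
  move=> mB; suff : <<s (@RGenCInfty.G R) >> `<=` [set B | S (setT `*` B)].
    by apply; rewrite -[X in X _](RGenCInfty.measurableE R).
  apply: smallest_sub => [|_ [a ->]].
    split => [|G SG|G SG] /=.
    - by rewrite setX0.
    - by rewrite setTD setTX -preimage_setC -setTX; exact: SC.
    - by rewrite setX_bigcupr; exact: SU.
  split => /=.
    apply: souslin_ext (souslin_rect M a M measurableT) => -[x y] /= yM.
    split=> [[_]|[_]]; rewrite /= !in_itv/= ?andbT; first by case/andP.
    by move=> ay; split => //=; rewrite ay (le_trans (ler_norm y)).
  (* Within [[- M, M]] the complement of a closed half-line is a countable union of closed
     intervals. *)
  have := souslin_bigcup (fun k : nat => souslin_rect M (- M) (a - k.+1%:R^-1) (@measurableT _ X)).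
  apply: souslin_ext => -[x y] /= yM; split.
    move=> [k _ [_]]; rewrite /= in_itv/= => /andP[_ yk] [_].
    rewrite in_itv/= andbT => ay; have : 0 < k.+1%:R^-1 :> R by rewrite invr_gt0.
    move: yk; move: (_^-1) => e yk e0; lra.
  move=> ny; have ya : y < a.
    by rewrite ltNge; apply/negP => h; apply: ny; split => //=; rewrite in_itv/= h.
  have [k hk] : exists k : nat, k.+1%:R^-1 < a - y.
    have /ltr_add_invr[k hk] : 0 < a - y by lra.
    by exists k; rewrite add0r in hk.
  exists k => //; split => //=; rewrite in_itv/=; move: yM; rewrite ler_norml => /andP[-> _].
  by move: hk; move: (_^-1) => e hk; lra.
rewrite measurable_prod_measurableType; apply: smallest_sub.
  by split => // G SG; rewrite setTD; exact: SC.
move=> _ [A mA] [B mB] <-; have [sB sBC] := cylB B mB.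
have -> : A `*` B = (A `*` setT) `&` (setT `*` B).
  by rewrite -setXI setIT setTI.
split; first by apply: souslinI => //; exact: cylA.
rewrite setCI; apply: souslinU => //.
by rewrite setXT preimage_setC -setXT; apply: cylA; exact: measurableC.
Qed.

End Souslin.

(** * Choquet capacitability and measurable branches of a tree *)

Section Selection.
Context d (X : measurableType d) (R : realType).
Variable mu : {finite_measure set X -> \bar R}.

Definition outer_le (S : set X) (a : R) :=
  exists M, [/\ measurable M, S `<=` M & (mu M <= a%:E)%E].

(** The covers [M n] need not increase; the intersections [N n] of all later covers do, and they
    still cover [S n]. *)
Lemma outer_le_bigcup (S : nat -> set X) a : nondecreasing_seq S ->
  (forall n, outer_le (S n) a) -> outer_le (\bigcup_n S n) a.
Proof.
move=> ndS /choice[M hM]; pose N n := \bigcap_(k in [set k | (n <= k)%N]) M k.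
have mN n : measurable (N n).
  by apply: bigcap_measurable => [|k _]; [exists n => /=|have [] := hM k].
have ndN : nondecreasing_seq N.
  by move=> m n mn; apply/subsetPset => x Nx k /= nk; apply: Nx; exact: leq_trans nk.
exists (\bigcup_n N n); split; first exact: bigcupT_measurable.
  move=> x [n _ Snx]; exists n => // k /= nk.
  by have [_ + _] := hM k; apply; have /subsetPset := ndS _ _ nk; apply.
have cN := nondecreasing_cvg_mu mN (bigcupT_measurable _ mN) ndN (mu := mu).
rewrite -(cvg_lim _ cN)//; apply: lime_le; first exact: cvgP cN.
apply: nearW => n /=; have [mM _ Ma] := hM n; apply: le_trans Ma.
by apply: le_measure; rewrite ?inE// => x /(_ n); apply => /=.
Qed.

Variable U : seq nat -> set X.
Hypothesis mU : forall w, measurable (U w).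
Hypothesis U_rcons : forall w j, U (rcons w j) `<=` U w.

Lemma U_cat v w : U (v ++ w) `<=` U v.
Proof.
elim/last_ind: w => [|w j IH]; first by rewrite cats0.
by rewrite -rcons_cat; apply: subset_trans IH.
Qed.

Definition branches_le (w : seq nat) := [set x | exists s : nat -> nat,
  (forall i, (i < size w)%N -> (s i <= nth 0%N w i)%N) /\ forall n, U (mkseq s n) x].

(** Some [j] bounds the entry of a branch at position [size w], so [branches_le w] is the increasing
    union of the [branches_le (rcons w j)]; by continuity of the outer measure they cannot all be
    small. *)
Lemma branches_le_rcons w a : ~ outer_le (branches_le w) a ->
  exists j, ~ outer_le (branches_le (rcons w j)) a.
Proof.
apply: contra_notP => /forallNP h.
have -> : branches_le w = \bigcup_j branches_le (rcons w j).
  apply/seteqP; split => x.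
    move=> [s [sw hs]]; exists (s (size w)) => //; exists s; split => // i.
    rewrite size_rcons ltnS leq_eqVlt => /predU1P[->|iw].
      by rewrite nth_rcons ltnn eqxx.
    by rewrite nth_rcons iw sw.
  move=> [j _ [s [sw hs]]]; exists s; split => // i iw.
  by have := sw i; rewrite size_rcons nth_rcons iw ltnS (ltnW iw); apply.
apply: outer_le_bigcup => [m n mn|j]; last by apply: contrapT; exact: h.
apply/subsetPset => x [s [sw hs]]; exists s; split => // i iw.
have := sw i; move: iw; rewrite !size_rcons !nth_rcons => iw /(_ iw).
by case: ifP => // _; case: ifP => // _ /leq_trans; apply.
Qed.

Lemma branches_le_seq a : ~ outer_le (branches_le [::]) a ->
  exists t : nat -> nat, forall n, ~ outer_le (branches_le (mkseq t n)) a.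
Proof.
move=> h0.
have /choice[f hf] (w : seq nat) : exists j, ~ outer_le (branches_le w) a ->
    ~ outer_le (branches_le (rcons w j)) a.
  have [hw|hw] := pselect (outer_le (branches_le w) a); first by exists 0%N.
  by have [j hj] := branches_le_rcons hw; exists j.
pose w := fix w n := if n is m.+1 then rcons (w m) (f (w m)) else [::].
exists (fun n => f (w n)) => n.
suff -> : mkseq (fun n => f (w n)) n = w n by elim: n => //= n; exact: hf.
by elim: n => //= n IH; rewrite mkseqS IH.
Qed.

Section bounded.
Variable t : nat -> nat.

Definition below (v : seq nat) := forall i, (i < size v)%N -> (nth 0%N v i <= t i)%N.

(** Finite extensions of every length stand in for an infinite branch: they involve only countable
    unions and intersections, which keeps the set measurable. *)
Definition tail_le v := [set x | forall k, exists u,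
  [/\ size u = k, below (v ++ u) & U (v ++ u) x]].

Lemma measurable_tail_le v : measurable (tail_le v).
Proof.
have -> : tail_le v = \bigcap_k \bigcup_(u in [set u | size u = k /\ below (v ++ u)]) U (v ++ u).
  apply/seteqP; split => x.
    by move=> h k _; have [u [? ? ?]] := h k; exists u.
  by move=> h k; have [u [? ?] ?] := h k I; exists u.
by apply: bigcapT_measurable => k; apply: countType_bigcup_measurable.
Qed.

(* Koenig's lemma. *)
Lemma tail_le_child v x : tail_le v x ->
  exists2 j, (j <= t (size v))%N & tail_le (rcons v j) x.
Proof.
move=> vx; apply: contrapT => h.
have /choice[k hk] j : exists k, (j <= t (size v))%N -> ~ exists u,
    [/\ size u = k, below (rcons v j ++ u) & U (rcons v j ++ u) x].
  have [jt|jt] := boolP (j <= t (size v))%N; last by exists 0%N.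
  have /existsNP[k hk] : ~ tail_le (rcons v j) x by move=> ?; apply: h; exists j.
  by exists k.
(* If each of the finitely many children died out at its depth [k j], no extension of [v] by more
   than the largest of these depths would survive. *)
pose K := \max_(j < (t (size v)).+1) k j.
have [[|j u] [// + bu Uu]] := vx K.+1; move=> [su].
have jt : (j <= t (size v))%N.
  by have := bu (size v); rewrite size_cat nth_cat ltnn subnn/=; apply; rewrite addnS ltnS leq_addr.
have kj : (k j <= K)%N.
  by rewrite /K (@leq_bigmax _ (fun i : 'I__ => k i) (Ordinal (jt : j < _.+1)%N)).
apply: (hk j jt); exists (take (k j) u); rewrite size_takel ?su//.
move: bu Uu; rewrite -cat_rcons -{1 2}(cat_take_drop (k j) u) catA => bu Uu.
split => //; last exact: U_cat Uu.
move=> i il; have := bu i; rewrite nth_cat il size_cat; apply.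
by rewrite (leq_trans il)// leq_addr.
Qed.

(** Taking the least surviving child makes the branch a measurable function of [x]. *)
Let step x v := find (fun j => `[< tail_le (rcons v j) x >]) (iota 0 (t (size v)).+1).

Let stepP x v : tail_le v x -> tail_le (rcons v (step x v)) x.
Proof.
move=> /tail_le_child[j jt jx].
have h : has (fun j => `[< tail_le (rcons v j) x >]) (iota 0 (t (size v)).+1).
  by apply/hasP; exists j; [rewrite mem_iota|exact/asboolP].
have := nth_find 0%N h; rewrite nth_iota ?add0n; first by move/asboolP.
by move: h; rewrite has_find size_iota.
Qed.

Let measurable_step v (Q : set nat) : measurable [set x | Q (step x v)].
Proof.
rewrite /step; elim: (iota _ _) Q => [|j s IH] Q /=.
  exact: measurable_prop.
have -> : [set x | Q (if `[< tail_le (rcons v j) x >] then 0%N else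
    (find (fun j => `[< tail_le (rcons v j) x >]) s).+1)] =
  (tail_le (rcons v j) `&` [set _ | Q 0%N]) `|` (~` tail_le (rcons v j) `&`
    [set x | [set i | Q i.+1] (find (fun j => `[< tail_le (rcons v j) x >]) s)]).
  apply/seteqP; split => x /=; case: asboolP => h; try by [left|right].
    by case=> -[].
  by case=> -[].
have mt := measurable_tail_le (rcons v j).
apply: measurableU; apply: measurableI => //; last exact: measurableC.
exact: measurable_prop.
Qed.

Let path x := fix path n := if n is m.+1 then rcons (path m) (step x (path m)) else [::].

Lemma tail_le_branch : exists s : X -> nat -> nat,
  (forall x, tail_le [::] x -> forall n, U (mkseq (s x) n) x) /\
  (forall n (Q : set (seq nat)), measurable [set x | Q (mkseq (s x) n)]).
Proof.
exists (fun x n => step x (path x n)).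
have E x n : mkseq (fun n => step x (path x n)) n = path x n.
  by elim: n => //= n IH; rewrite mkseqS IH.
split.
  move=> x x0 n; rewrite E.
  have /(_ 0%N)[u [/eqP/nilP->]] : tail_le (path x n) x.
    by elim: n => //= n IH; exact: stepP.
  by rewrite cats0.
move=> n Q; under eq_set do rewrite E.
elim: n Q => [|n IH] Q /=.
  exact: measurable_prop.
have -> : [set x | Q (rcons (path x n) (step x (path x n)))] =
  \bigcup_(v in setT) ([set x | [set v] (path x n)] `&`
                       [set x | [set j | Q (rcons v j)] (step x v)]).
  apply/seteqP; split => x /=; first by exists (path x n).
  by move=> [v _ [/= <-]].
by apply: countType_bigcup_measurable => v _; apply: measurableI.
Qed.

End bounded.

(* The points with a branch of length [k] below [t] form a measurable set of
   measure larger than [a], and by Koenig's lemma these sets decrease to the set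
   of points with an infinite branch below [t]. *)
Lemma branch_selection a : ~ outer_le (branches_le [::]) a ->
  exists (A : set X) (s : X -> nat -> nat), [/\ measurable A, (a%:E <= mu A)%E,
    forall x, A x -> forall n, U (mkseq (s x) n) x &
    forall n (Q : set (seq nat)), measurable [set x | Q (mkseq (s x) n)]].
Proof.
move=> /branches_le_seq[t ht].
have [s [sU ms]] := tail_le_branch t.
exists (tail_le t [::]), s; split => //; first exact: measurable_tail_le.
pose W k := \bigcup_(u in [set u | size u = k /\ below t u]) U u.
have mW k : measurable (W k) by exact: countType_bigcup_measurable.
have WE : tail_le t [::] = \bigcap_k W k.
  apply/seteqP; split => x.
    by move=> h k _; have [u [? ? ?]] := h k; exists u.
  by move=> h k; have [u [? ?] ?] := h k I; exists u.
have niW : nonincreasing_seq W.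
  move=> m n mn; apply/subsetPset => x [u [un bu] Uu].
  exists (take m u); first split.
  - by rewrite size_takel// un.
  - move=> i; rewrite size_takel ?un// => im; rewrite nth_take//; apply: bu.
    by rewrite un (leq_trans im).
  - by apply: (@U_cat _ (drop m u)); rewrite cat_take_drop.
have cW := nonincreasing_cvg_mu _ mW (bigcapT_measurable mW) niW (mu := mu).
rewrite WE -(cvg_lim _ (cW _))//; last by rewrite ltey_eq fin_num_measure.
apply: lime_ge; first by apply: cvgP (cW _); rewrite ltey_eq fin_num_measure.
apply: nearW => k /=; rewrite leNgt; apply/negP => Wa; apply: (ht k).
exists (W k); split => //; last exact: ltW.
move=> x [r [rt Ur]]; exists (mkseq r k) => //; split; first by rewrite size_mkseq.
move=> i; rewrite size_mkseq => ik; rewrite nth_mkseq//.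
by have := rt i; rewrite size_mkseq nth_mkseq// => ->.
Qed.

End Selection.

(** * Selectors for measurable sets with real sections *)

Section SectionSelection.
Context d (X : measurableType d) (R : realType).

Lemma measurable_fun_countable_range (I : countType) (s : X -> I) (g : I -> R) :
  (forall Q : set I, measurable [set x | Q (s x)]) ->
  measurable_fun setT (fun x => g (s x)).
Proof. by move=> ms _ B mB; rewrite setTI; exact: (ms (g @^-1` B)). Qed.

(** A node keeps the first sides of its cells and the condition, free of [x], that their intervals
    meet pairwise. Along a branch the supremum of the left ends then stays below every right end, so
    it lies in all the intervals. *)
Lemma souslin_selection (mu : {finite_measure set X -> \bar R}) M (F : set (X * R)) a :
  souslin M F ->
  ~ outer_le mu [set x | exists2 y, `|y| <= M & F (x, y)] a ->
  exists (A : set X) (phi : X -> R), [/\ measurable A, (a%:E <= mu A)%E,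
    measurable_fun setT phi & forall x, A x -> F (x, phi x)].
Proof.
move=> [P [mP hP]] nF.
(* Clipping to [[- M, M]] keeps the selected ordinate in the strip where the scheme describes
   [F]. *)
pose l w := Num.max (- M) (P w).2.1; pose r w := Num.min M (P w).2.2.
pose compat w := forall i j : nat, (i <= size w)%N -> (j <= size w)%N ->
  l (take i w) <= r (take j w).
pose U w := [set x | compat w /\ forall i : nat, (i <= size w)%N -> (P (take i w)).1 x].
have mU w : measurable (U w).
  have [c|c] := pselect (compat w); last first.
    by rewrite (_ : U w = set0)//; apply/seteqP; split => // x [].
  rewrite (_ : U w = \bigcap_(i in [set i : nat | (i <= size w)%N]) (P (take i w)).1).
    by apply: bigcap_measurable => [|k _]; [exists 0%N|exact: mP].
  by apply/seteqP; split => x => [[]|h]; [|split].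
have take_le (w : seq nat) j i : (i <= size w)%N -> take i (rcons w j) = take i w.
  by move=> iw; rewrite -cats1 takel_cat.
have Ur w j : U (rcons w j) `<=` U w.
  move=> x [c Px]; split=> [i k iw kw|i iw].
    by have := c i k; rewrite !take_le// size_rcons; apply; exact: leqW.
  by have := Px i; rewrite take_le// size_rcons; apply; exact: leqW.
have take_mkseq (s : nat -> nat) i n : (i <= n)%N -> take i (mkseq s n) = mkseq s i.
  by move=> i_n; rewrite /mkseq -map_take take_iota (minn_idPl i_n).
have [|A [s [mA aA sU ms]]] := @branch_selection _ _ _ mu U mU Ur a.
  apply: contra_not nF => -[N [mN sN Na]]; exists N; split => // x [y yM /(hP (_, _) yM)[s hs]].
  apply: sN; exists s; split => [[]|n] //; split=> [i j|i]; rewrite size_mkseq => il.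
    move=> jl; rewrite !take_mkseq//.
    have [_ /andP[h1 _]] := hs i; have [_ /andP[_ h2]] := hs j.
    move: yM; rewrite ler_norml => /andP[h3 h4].
    by apply: (@le_trans _ _ y); rewrite ?ge_max ?le_min ?h1 ?h2 ?h3 ?h4.
  by rewrite take_mkseq//; have [] := hs i.
pose g n x := l (mkseq (s x) n).
have mg n : measurable_fun setT (g n).
  by apply: (@measurable_fun_countable_range _ (fun x => mkseq (s x) n) l); exact: ms.
pose G n x := (g n x)%:E.
pose phi x := fine (esups (G ^~ x) 0%N).
exists A, phi; split => //.
  apply: (measurableT_comp (f := fine)) => //; apply: measurable_fun_esups => n.
  exact/measurable_EFinP.
move=> x Ax.
have lr n m : g n x <= r (mkseq (s x) m).
  have := sU x Ax (maxn n m) => -[/(_ n m)]; rewrite size_mkseq leq_maxl leq_maxr.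
  by rewrite !take_mkseq ?leq_maxl ?leq_maxr// => /(_ isT isT).
have Ge n : (G n x <= esups (G ^~ x) 0%N)%E.
  by apply: ereal_sup_ubound; exists n.
have eG m : (esups (G ^~ x) 0%N <= (r (mkseq (s x) m))%:E)%E.
  by apply: ub_ereal_sup => _ [n _ <-]; rewrite lee_fin.
have fG : esups (G ^~ x) 0%N \is a fin_num.
  rewrite fin_numE; apply/andP; split; apply/eqP => h.
    by have := Ge 0%N; rewrite h leeNy_eq.
  by have := eG 0%N; rewrite h leye_eq.
have Gphi n : g n x <= phi x by rewrite -lee_fin fineK//; exact: Ge.
have phir m : phi x <= r (mkseq (s x) m) by rewrite -lee_fin fineK.
have phiM : `|phi x| <= M.
  have := Gphi 0%N; have := phir 0%N; rewrite /g /l /r ge_max le_min ler_norml.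
  by move=> /andP[-> _] /andP[-> _].
apply/(hP (_, _) phiM); exists (s x) => n; split => /=.
  have [_ /(_ n)] := sU x Ax n; rewrite size_mkseq take_mkseq//; exact.
have := Gphi n; have := phir n; rewrite /g /l /r ge_max le_min.
by move=> /andP[_ ->] /andP[_ ->].
Qed.

Variable mu : probability X R.

(** The projections of the strips [|y| <= M] increase to a set containing almost every point, so one
    of them already has outer measure above [1 - e]. *)
Lemma selection_eps (F : set (X * R)) (e : R) : measurable F -> 0 < e ->
  {ae mu, forall x, exists y, F (x, y)} ->
  exists (A : set X) (phi : X -> R), [/\ measurable A, ((1 - e)%:E <= mu A)%E,
    measurable_fun setT phi & forall x, A x -> F (x, phi x)].
Proof.
move=> mF e0 aeF.
suff [M hM] : exists M : nat, ~ outer_le mu [set x | exists2 y, `|y| <= M%:R & F (x, y)] (1 - e).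
  by have := souslin_selection (measurable_souslin M%:R mF) hM.
apply/not_existsP => h; have : outer_le mu (\bigcup_M [set x | exists2 y, `|y| <= M%:R & F (x, y)]) (1 - e).
  apply: outer_le_bigcup => [m n mn|n]; last by apply: contrapT; exact: h.
  apply/subsetPset => x [y yM Fy]; exists y => //.
  by rewrite (le_trans yM)// ler_nat.
move=> [N [mN sN Ne]]; case: aeF => Z [mZ Z0 sZ].
have : (mu setT <= mu N + mu Z)%E.
  apply: le_trans (measureU2 _ _ _) => //; apply: le_measure; rewrite ?inE//.
    exact: measurableU.
  move=> x _; have [[y Fy]|nF] := pselect (exists y, F (x, y)); last by right; apply: sZ.
  left; apply: sN; exists (Num.truncn `|y|).+1 => //; exists y => //.
  by rewrite ltW// truncnS_gt.
rewrite probability_setT Z0 adde0 => /le_trans/(_ Ne); rewrite lee_fin; lra.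
Qed.

(** The selectors for [e = n.+1%:R^-1] are patched: [x] uses the first one, of index [N x], whose
    domain contains it. *)
Lemma selection_ae (F : set (X * R)) : measurable F ->
  {ae mu, forall x, exists y, F (x, y)} ->
  exists (A : set X) (phi : X -> R), [/\ measurable A, mu (~` A) = 0%E,
    measurable_fun setT phi & forall x, A x -> F (x, phi x)].
Proof.
move=> mF aeF.
have /choice[A /choice[phi hA]] (n : nat) : exists (A : set X) (phi : X -> R),
    [/\ measurable A, ((1 - n.+1%:R^-1)%:E <= mu A)%E,
      measurable_fun setT phi & forall x, A x -> F (x, phi x)].
  by apply: selection_eps.
have mA n : measurable (A n) by have [] := hA n.
have mB : measurable (\bigcup_n A n) by exact: bigcupT_measurable.
pose N x := if pselect (exists n, `[< A n x >]) is left h then ex_minn h else 0%N.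
have AN x : (\bigcup_n A n) x -> A (N x) x /\ forall i, A i x -> (N x <= i)%N.
  move=> [n _ An]; rewrite /N; case: pselect => [h|]; last by case; exists n; exact/asboolP.
  by case: ex_minnP => m /asboolP Am mmin; split => // i Ai; apply: mmin; exact/asboolP.
have AN0 x : ~ (\bigcup_n A n) x -> N x = 0%N.
  move=> nx; rewrite /N; case: pselect => // h; exfalso; apply: nx.
  by case: (h) => k /asboolP Ak; exists k.
have mN (Q : set nat) : measurable [set x | Q (N x)].
  have mNn n : measurable [set x | N x = n].
    have mlt : measurable (A n `&` \bigcap_(i in [set i : nat | (i < n)%N]) ~` A i).
      apply: measurableI => //; case: n => [|n].
        by rewrite (_ : [set _ | _] = set0) ?bigcap_set0//; apply/seteqP; split.
      by apply: bigcap_measurable => [|i _]; [exists 0%N|exact: measurableC].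
    have AnE : A n `&` \bigcap_(i in [set i : nat | (i < n)%N]) ~` A i =
        (\bigcup_n A n) `&` [set x | N x = n].
      apply/seteqP; split => x.
        move=> [Anx ltn]; have Ux : (\bigcup_n A n) x by exists n.
        have [ANx mmin] := AN x Ux; split => //=; apply/eqP; rewrite eqn_leq mmin//=.
        by rewrite leqNgt; apply/negP => mn; exact: (ltn _ mn ANx).
      move=> [Ux Nx]; have [ANx mmin] := AN x Ux; split; first by rewrite -Nx.
      by move=> i /= i_n Ai; have := mmin _ Ai; rewrite leqNgt Nx i_n.
    rewrite -(setIT [set x | N x = n]) -(setUv (\bigcup_n A n)) setIUr.
    apply: measurableU; first by rewrite setIC -AnE.
    have [->|n0] := eqVneq n 0%N.
      rewrite (_ : _ `&` _ = ~` \bigcup_n A n); first exact: measurableC.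
      apply/seteqP; split => [x []//|x nx]; split => //=.
      exact: AN0.
    rewrite (_ : _ `&` _ = set0)//; apply/seteqP; split => // x [/= Nx nx].
    by move: (AN0 x nx); rewrite Nx => /eqP; rewrite (negbTE n0).
  rewrite (_ : [set x | Q (N x)] = \bigcup_(n in Q) [set x | N x = n]).
    exact: countType_bigcup_measurable.
  by apply/seteqP; split => [x Qx|x [n Qn /= ->]//]; exists (N x).
exists (\bigcup_n A n), (fun x => phi (N x) x); split => //.
- apply/eqP; rewrite eq_le measure_ge0 andbT; apply/lee_addgt0Pr => e e0.
  have [k hk] : exists k, 0 + k.+1%:R^-1 < e by exact: ltr_add_invr.
  have [_ kA _ _] := hA k; rewrite add0e probability_setC//.
  have : ((1 - k.+1%:R^-1)%:E <= mu (\bigcup_n A n))%E.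
    by rewrite (le_trans kA)// le_measure ?inE//; exact: bigcup_sup.
  have : mu (\bigcup_n A n) \is a fin_num by rewrite fin_num_measure.
  case: (mu _) => // r _; rewrite -EFinB !lee_fin add0r in hk *.
  move: hk; move: (_^-1) => q hk; lra.
- move=> _ B mB'; rewrite setTI.
  rewrite (_ : _ @^-1` B = \bigcup_n ([set x | [set n] (N x)] `&` phi n @^-1` B)).
    apply: bigcupT_measurable => n; apply: measurableI => //.
    by rewrite -[_ @^-1` _]setTI; have [_ _ + _] := hA n; apply.
  by apply/seteqP; split => [x Bx|x [n _ [/= <-]]//]; exists (N x).
- by move=> x Ux; have [_ _ _] := hA (N x); apply; exact: (AN x Ux).1.
Qed.
End SectionSelection.

(** * Transfer to standard Borel spaces *)

Section Transfer.
Context d (X : measurableType d) (R : realType).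
Hypothesis stdX : @standard_borel d X R.

(** With [g], a real number can stand for a point of [X], which carries selection over from [X * R].
    Measurability of [g] uses that [f] sends measurable sets to measurable sets. *)
Lemma standard_borel_retract : exists (f : X -> R) (g : R -> X),
  [/\ measurable_fun setT f, measurable_fun setT g & cancel f g].
Proof.
have [f [B [mB [mf [injf [fB fimg]]]]]] := stdX.
have injf' : injective f by move=> x y xy; apply: injf; rewrite ?inE.
pose g r := if pselect (exists x, f x = r) is left h then sval (cid h) else point.
have fK : cancel f g.
  move=> x; rewrite /g; case: pselect => [h|[]]; last by exists x.
  by apply: injf'; case: cid.
exists f, g; split => //.
move=> _ S mS; rewrite setTI.
rewrite (_ : g @^-1` S = f @` S `|` (~` B `&` [set _ | S point])).
  apply: measurableU; first exact: fimg.
  by apply: measurableI; [exact: measurableC|exact: measurable_prop].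
apply/seteqP; split => [r /=|r].
  rewrite /g; case: pselect => [h|h] Sr.
    by left; case: cid Sr => x /= <- Sx; exists x.
  by right; split => //; rewrite -fB => -[x _ fx]; apply: h; exists x.
move=> [[x Sx <-]|[nB Sp]] /=; first by rewrite fK.
by rewrite /g; case: pselect => // -[x fx]; case: nB; rewrite -fB; exists x.
Qed.

Lemma measurable_eq_fun d' (T : measurableType d') (f g : T -> X) :
  measurable_fun setT f ->
  measurable_fun setT g -> measurable [set x | f x = g x].
Proof.
move=> mf mg; have [h [k [mh _ hK]]] := standard_borel_retract.
have := measurable_fun_eqr (measurableT_comp mh mf) (measurableT_comp mh mg).
move=> /(_ measurableT [set true] I); rewrite setTI; congr measurable.
apply/seteqP; split => x /=; first by move/eqP/(can_inj hK).
by move=> ->; rewrite eqxx.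
Qed.

Variable mu : probability X R.

Lemma measurable_selection (E : set (X * X)) : measurable E ->
  {ae mu, forall x, exists y, E (x, y)} ->
  exists (A : set X) (phi : X -> X), [/\ measurable A, mu (~` A) = 0%E,
    measurable_fun setT phi & forall x, A x -> E (x, phi x)].
Proof.
move=> mE aeE; have [f [g [mf mg fK]]] := standard_borel_retract.
pose F := [set z : X * R | E (z.1, g z.2)].
have mF : measurable F.
  rewrite -[F]setTI; apply: (_ : measurable_fun setT (fun z : X * R => (z.1, g z.2))) => //.
  by apply/measurable_fun_pair; [exact: measurable_fst|exact: measurableT_comp].
have [|A [phi [mA A0 mphi AF]]] := selection_ae mF (mu := mu).
  by apply: filterS aeE => x [y Exy]; exists (f y); rewrite /F /= fK.
by exists A, (g \o phi); split => //; exact: measurableT_comp.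
Qed.
End Transfer.

(** * Neighbour functions *)

Lemma card_injective_surjective (T : Type) (A : set T) n (f : nat -> T) :
  A #= `I_n -> (forall i, (i < n)%N -> A (f i)) ->
  (forall i j, (i < n)%N -> (j < n)%N -> f i = f j -> i = j) ->
  forall y, A y -> exists2 i, (i < n)%N & f i = y.
Proof.
move=> An fA finj y Ay; apply: contrapT => ny.
pose g i := if (i < n)%N then f i else y.
have gA : g @` `I_n.+1 `<=` A.
  by move=> _ [i _ <-]; rewrite /g; case: ifPn => // /fA.
have ginj : set_inj `I_n.+1 g.
  move=> i j /set_mem/= i_n /set_mem/= j_n; rewrite /g.
  case: ifPn => hi; case: ifPn => hj; [exact: finj|move=> fy|move=> fy|move=> _]; last by lia.
    by case: ny; exists i.
  by case: ny; exists j.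
have : `I_n.+1 #<= `I_n.
  rewrite -(card_le_eqr An) -(card_le_eql (inj_card_eq ginj)).
  exact: subset_card_le.
by rewrite card_le_II ltnn.
Qed.

Section Neighbors.
Context d (X : measurableType d) (R : realType) (mu : probability X R).
Hypothesis stdX : @standard_borel d X R.
Variables (E : set (X * X)) (D : nat).
Hypotheses (mE : measurable E) (regE : d_regular mu E D).

(** Each new selector avoids the graphs of the earlier ones; a section with [D] points is not
    exhausted by [k < D] of them. *)
Lemma neighbor_selectors_upto k : (k <= D)%N -> exists (A : set X) (phi : nat -> X -> X),
  [/\ measurable A, mu (~` A) = 0%E, forall i, (i < k)%N -> measurable_fun setT (phi i) &
    forall x, A x -> (forall i, (i < k)%N -> E (x, phi i x)) /\
      (forall i j, (i < k)%N -> (j < k)%N -> phi i x = phi j x -> i = j)].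
Proof.
elim: k => [_|k IH kD].
  by exists setT, (fun _ => id); split => //; rewrite setCT measure0.
have [A [phi [mA A0 mphi Aphi]]] := IH (ltnW kD).
pose F := E `&` \bigcap_(i in [set i : nat | (i < k)%N]) [set z | z.2 <> phi i z.1].
have mF : measurable F.
  apply: measurableI => //.
  have [->|/set0P[i0 hi0]] := eqVneq [set i : nat | (i < k)%N] set0; first by rewrite bigcap_set0.
  apply: bigcap_measurable => [|i /= ik]; first by exists i0.
  rewrite (_ : [set z | _] = ~` [set z : X * X | z.2 = phi i z.1]) //.
  apply: measurableC; apply: (measurable_eq_fun stdX); first exact: measurable_snd.
  exact: measurableT_comp (mphi _ ik) measurable_fst.
have aeF : {ae mu, forall x, exists y, F (x, y)}.
  have aeA : {ae mu, forall x, A x} by exists (~` A); split => //; exact: measurableC.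
  apply: filterS2 aeA regE => x Ax xD; apply: contrapT => nF.
  have [E1 inj1] := Aphi x Ax.
  have : `I_D #<= `I_k.
    rewrite -(card_le_eql xD); apply: (card_le_trans _ (card_image_le (phi ^~ x) `I_k)).
    apply: subset_card_le => y Exy; apply: contrapT => ny; apply: nF; exists y.
    by split => // i ik yphi; apply: ny; exists i.
  by rewrite card_le_II leqNgt kD.
have [B [psi [mB B0 mpsi Bpsi]]] := measurable_selection stdX mF aeF.
exists (A `&` B), (fun i => if (i < k)%N then phi i else psi); split.
- exact: measurableI.
- apply/eqP; rewrite eq_le measure_ge0 andbT setCI -[leRHS]adde0 -{1}A0 -B0.
  by apply: measureU2; exact: measurableC.
- by move=> i _; case: ifPn => // /mphi.
- move=> x [Ax Bx]; have [E1 inj1] := Aphi x Ax; have [E2 ne] := Bpsi x Bx; split.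
    by move=> i _; case: ifPn => // /E1.
  move=> i j; rewrite !ltnS; case: ifPn => hi; case: ifPn => hj ik jk.
  - exact: inj1.
  - by move=> /esym /(ne _ hi).
  - by move=> /(ne _ hj).
  - by move=> _; lia.
Qed.

Lemma neighbor_selectors : exists (A : set X) (phi : 'I_D -> X -> X),
  [/\ measurable A, mu (~` A) = 0%E, forall i, measurable_fun setT (phi i) &
    forall x, A x -> (forall y, E (x, y) <-> exists i, y = phi i x) /\
      injective (phi ^~ x)].
Proof.
have [A [phi [mA A0 mphi Aphi]]] := neighbor_selectors_upto (leqnn D).
have [N [mN N0 sN]] := regE.
exists (A `\` N), (fun i : 'I_D => phi i); split.
- exact: measurableD.
- apply/eqP; rewrite eq_le measure_ge0 andbT setCD -[leRHS]adde0 -{1}A0 -N0.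
  by apply: measureU2 => //; exact: measurableC.
- by move=> i; exact: mphi.
- move=> x [Ax Nx]; have xD : nbhd E x #= `I_D by apply: contrapT => h; apply: Nx; exact: sN.
  have [E1 inj1] := Aphi x Ax; split.
    move=> y; split=> [Exy|[i ->]]; last exact: E1.
    have [i iD <-] := card_injective_surjective xD E1 inj1 Exy.
    by exists (Ordinal iD).
  by move=> i j /inj1 h; apply/val_inj/h.
Qed.

End Neighbors.

Lemma adj_opE d (X : measurableType d) (R : realType) (E : set (X * X)) D
    (phi : 'I_D -> X -> X) x :
  (forall y, E (x, y) <-> exists i, y = phi i x) -> injective (phi ^~ x) ->
  forall f : X -> R, adj_op E f x = \sum_i f (phi i x).
Proof.
move=> Ex inj f.
have nE : nbhd E x = [set` [seq phi i x | i <- enum 'I_D]].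
  apply/seteqP; split => y /=.
    by move=> /Ex[i ->]; apply/mapP; exists i; rewrite // mem_enum.
  by move=> /mapP[i _ ->]; apply/Ex; exists i.
rewrite /adj_op; case: pselect => [h|[]]; last by rewrite nE; exact: finite_seq.
rewrite nE -fsbig_seq; last by rewrite map_inj_uniq ?enum_uniq.
by rewrite big_map big_enum; exact: eq_bigl.
Qed.

Lemma cvg_sum_seq (R : realType) (I : Type) (s : seq I) (u : I -> nat -> R) (l : I -> R) :
  (forall i, u i @ \oo --> l i) ->
  (fun n => \sum_(i <- s) u i n) @ \oo --> \sum_(i <- s) l i.
Proof.
move=> ul; elim: s => [|i s IH].
  by rewrite big_nil; under eq_fun do rewrite big_nil; exact: cvg_cst.
by rewrite big_cons; under eq_fun do rewrite big_cons; exact: cvgD.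
Qed.

Lemma inL2_bounded d (X : measurableType d) (R : realType) (mu : probability X R)
    (f : X -> R) (C : R) : measurable_fun setT f -> (forall x, `|f x| <= C) -> inL2 mu f.
Proof.
move=> mf fC; split => //.
apply: (@le_lt_trans _ _ (\int[mu]_(x in setT) (C ^+ 2)%:E)%E).
  apply: ge0_le_integral => //.
  - by move=> x _; rewrite lee_fin sqr_ge0.
  - by apply/measurable_EFinP; exact: measurable_funX.
  - move=> x _; rewrite lee_fin -[f x ^+ 2]real_normK ?num_real//.
    by rewrite ler_pXn2r ?nnegrE// (le_trans _ (fC x)).
rewrite integral_cst//; apply: lte_mul_pinfty; rewrite ?lee_fin ?sqr_ge0//.
exact: (le_lt_trans (probability_le1 mu measurableT) (ltry 1)).
Qed.

(** * Conull sets closed under neighbours *)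

Section Invariant.
Context d (X : measurableType d) (R : realType) (mu : probability X R).
Variables (E : set (X * X)) (D : nat) (A : set X) (phi : 'I_D -> X -> X).
Hypotheses (mA : measurable A) (A0 : mu (~` A) = 0%E).
Hypothesis mphi : forall i, measurable_fun setT (phi i).
Hypothesis EA : forall x, A x ->
  (forall y, E (x, y) <-> exists i, y = phi i x) /\ injective (phi ^~ x).
Hypothesis inj_res : forall f, inL2 mu f ->
  {ae mu, forall x, adj_op E f x - D.+1%:R * f x = 0} -> {ae mu, forall x, f x = 0 :> R}.

Lemma conullI (U V : set X) : measurable U -> measurable V ->
  mu (~` U) = 0%E -> mu (~` V) = 0%E -> mu (~` (U `&` V)) = 0%E.
Proof.
move=> mU mV U0 V0; apply/eqP; rewrite eq_le measure_ge0 andbT.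
rewrite setCI -[leRHS]adde0 -{1}U0 -V0.
by apply: measureU2; exact: measurableC.
Qed.

(* The discounted probability [f] of reaching the complement of [Z] is an
   eigenfunction for the eigenvalue [D + 1], hence vanishes almost everywhere. *)
Lemma invariant_conull (Z : set X) : measurable Z -> mu (~` Z) = 0%E ->
  exists Y, [/\ measurable Y, mu (~` Y) = 0%E, Y `<=` Z `&` A &
    forall x, Y x -> forall i, Y (phi i x)].
Proof.
move=> mZ Z0; pose W := Z `&` A.
have mW : measurable W by exact: measurableI.
have W0 : mu (~` W) = 0%E by exact: conullI.
(* Each of the [D] neighbours has weight [1 / (D + 1)]: the iterates stay at most 1, and on the
   conull set [W] the fixed point equation is the eigenvalue equation for [D + 1]. *)
pose F (f : X -> R) x := \1_W x * (D.+1%:R^-1 * \sum_i f (phi i x)) + \1_(~` W) x.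
pose f n := iter n F (fun=> 0).
have FW g x : W x -> F g x = D.+1%:R^-1 * \sum_i g (phi i x).
  move=> Wx; rewrite /F !indicE mem_set// memNset; last by move=> /(_ Wx).
  by rewrite mul1r addr0.
have FNW g x : ~ W x -> F g x = 1.
  by move=> Wx; rewrite /F !indicE memNset// mem_set// mul0r add0r.
have mF g : measurable_fun setT g -> measurable_fun setT (F g).
  move=> mg; apply: measurable_funD; last by apply: measurable_indic; exact: measurableC.
  apply: measurable_funM; first exact: measurable_indic.
  apply: measurable_funM => //; apply: measurable_sum => i.
  exact: measurableT_comp.
have D1 : 0 < D.+1%:R^-1 :> R by rewrite invr_gt0.
have mf n : measurable_fun setT (f n) by elim: n => //= n IH; exact: mF.
have F_le g h : (forall x, g x <= h x) -> forall x, F g x <= F h x.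
  move=> gh x; have [Wx|Wx] := pselect (W x); last by rewrite !FNW.
  by rewrite !FW// ler_pM2l// ler_sum.
have f_ge0 n x : 0 <= f n x.
  elim: n x => //= n IH x; have [Wx|Wx] := pselect (W x); last by rewrite FNW.
  by rewrite FW// pmulr_rge0// sumr_ge0.
have f_mono n x : f n x <= f n.+1 x.
  elim: n x => [x|n IH x]; first exact: (f_ge0 1%N).
  exact: F_le.
have f_le1 n x : f n x <= 1.
  elim: n x => //= n IH x; have [Wx|Wx] := pselect (W x); last by rewrite FNW.
  rewrite FW// mulrC ler_pdivrMr// mul1r.
  apply: (@le_trans _ _ (\sum_(i < D) 1)); first by apply: ler_sum.
  by rewrite sumr_const card_ord ler_nat.
have cvgf x : cvgn (f ^~ x).
  apply: nondecreasing_is_cvgn; first by apply/nondecreasing_seqP => n; exact: f_mono.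
  by exists 1 => _ [n _ <-].
pose g x := limn (f ^~ x).
have fg x : f ^~ x @ \oo --> g x by exact: cvgf.
have fg1 x : (fun n => f n.+1 x) @ \oo --> g x.
  by have := fg x; rewrite -(cvg_shiftS (f ^~ x) (nbhs (g x))).
have mg : measurable_fun setT g by exact: measurable_fun_cvg mf _.
have g_ge0 x : 0 <= g x by apply: limr_ge => //; exact: nearW.
have g_le1 x : g x <= 1 by apply: limr_le => //; exact: nearW.
have gW x : W x -> \sum_i g (phi i x) = D.+1%:R * g x.
  move=> Wx; have h1 : (fun n => \sum_i f n (phi i x)) @ \oo --> \sum_i g (phi i x).
    exact: cvg_sum_seq.
  have h2 : (fun n => D.+1%:R * f n.+1 x) @ \oo --> D.+1%:R * g x.
    by apply: cvgMr; exact: fg1.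
  apply: (cvg_unique _ h1) => //.
  suff <- : (fun n => D.+1%:R * f n.+1 x) = (fun n => \sum_i f n (phi i x)) by [].
  by apply/funext => n; rewrite /= FW// mulrA mulfV ?mul1r// pnatr_eq0.
have gNW x : ~ W x -> g x = 1.
  move=> Wx; apply: (cvg_unique _ (fg1 x)) => //.
  by rewrite (_ : (fun n => _) = cst 1); [exact: cvg_cst|apply/funext => n; exact: FNW].
have g0 : {ae mu, forall x, g x = 0}.
  apply: inj_res.
    by apply: (inL2_bounded (C := 1) mu mg) => x; rewrite ger0_norm.
  exists (~` W); split => //; first exact: measurableC.
  move=> x /= nx Wx; apply: nx; have [Ex ix] := EA Wx.2.
  by rewrite (adj_opE Ex ix) gW// subrr.
have mY : measurable [set x | g x = 0] by rewrite -[X in measurable X]setTI; exact: (mg measurableT [set 0]).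
exists [set x | g x = 0]; split => //.
- by apply/negligibleP; [exact: measurableC|exact: g0].
- move=> x /= gx; apply: contrapT => /gNW; rewrite gx => /eqP.
  by rewrite eq_sym oner_eq0.
- move=> x gx i; have Wx : W x.
    by apply: contrapT => /gNW; rewrite gx => /eqP; rewrite eq_sym oner_eq0.
  have := gW x Wx; rewrite gx mulr0 => /eqP; rewrite psumr_eq0// => /allP/(_ i).
  by rewrite mem_index_enum => /(_ isT)/eqP.
Qed.

End Invariant.

(** * The mass transport principle *)

Lemma ge0_integral_mrestr d (X : measurableType d) (R : realType)
    (mu : {measure set X -> \bar R}) (A : set X) (mA : measurable A) (f : X -> \bar R) :
  measurable_fun setT f -> (forall x, 0 <= f x)%E ->
  (\int[mrestr mu mA]_x f x = \int[mu]_(x in A) f x)%E.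
Proof.
move=> mf f0.
rewrite (@ge0_negligible_integral _ _ _ (mrestr mu mA) setT (~` A))//.
- rewrite setTD setCK; apply: eq_measure_integral => B mB BA.
  by rewrite /= /mrestr (setIidl BA).
- exact: measurableC.
- by have : mrestr mu mA (~` A) = 0%E by rewrite /mrestr setICl measure0.
Qed.

Section MassTransport.
Context d (X : measurableType d) (R : realType) (mu : probability X R).
Hypothesis stdX : @standard_borel d X R.
Variables (E : set (X * X)) (D : nat) (Y : set X) (phi : 'I_D -> X -> X).
Hypothesis E_sym : forall x y, E (x, y) -> E (y, x).
Hypotheses (pmp : graph_pmp mu E) (mY : measurable Y).
Hypothesis mphi : forall i, measurable_fun setT (phi i).
Hypothesis EY : forall x, Y x ->
  (forall y, E (x, y) <-> exists i, y = phi i x) /\ injective (phi ^~ x).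
Hypothesis phiY : forall x, Y x -> forall i, Y (phi i x).

(** On this piece [phi i] is a partial bijection along edges, onto [back j i] with inverse [phi j],
    so the measure-preserving hypothesis applies. For fixed [i] the pieces partition [Y]. *)
Definition back (i j : 'I_D) := Y `&` [set x | phi j (phi i x) = x].

Lemma measurable_back i j : measurable (back i j).
Proof.
apply: measurableI => //; apply: (measurable_eq_fun stdX) => //.
exact: measurableT_comp.
Qed.

Lemma bigcup_back i : Y = \big[setU/set0]_(j <- enum 'I_D) back i j.
Proof.
rewrite -bigcup_seq; apply/seteqP; split => [x Yx|x [j _ []//]].
have [/(_ x)/iff_refl[h _] _] := EY (phiY Yx i).
have [|j xj] := h; last by exists j => //=; rewrite mem_enum.
by apply: E_sym; apply/(EY Yx).1; exists i.
Qed.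

Lemma trivIset_back i : trivIset setT (back i).
Proof.
move=> j k _ _ [x [[Yx xj] [_ xk]]].
by apply: (EY (phiY Yx i)).2; rewrite xj xk.
Qed.

Lemma measure_back i j (S : set X) : measurable S ->
  mu (phi i @^-1` S `&` back i j) = mu (S `&` back j i).
Proof.
move=> mS.
have mpre (k : 'I_D) (U : set X) : measurable U -> measurable (phi k @^-1` U).
  by move=> mU; rewrite -[_ @^-1` _]setTI; exact: mphi.
have img (U : set X) : U `<=` back i j -> phi i @` U = back j i `&` phi j @^-1` U.
  move=> Ub; apply/seteqP; split => [_ [x Ux <-]|y [[Yy yE] Uy]].
    have [Yx xE] := Ub _ Ux; split; first by split; [exact: phiY|rewrite /= xE].
    by rewrite /= xE.
  by exists (phi j y).
have -> : S `&` back j i = phi i @` (phi i @^-1` S `&` back i j).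
  rewrite img; last exact: subIsetr.
  apply/seteqP; split => [y [Sy [Yy yE]]|y [[Yy yE] [Sy _]]]; split => //.
    split; first by rewrite /= yE.
    by split; [exact: phiY|rewrite /= yE].
  by rewrite /= yE in Sy.
apply/esym/(pmp (A := back i j)) => //.
- split; first exact: measurable_back.
  split; first exact: measurable_funTS.
  split.
    move=> x y /set_mem[_ /= xE] /set_mem[_ /= yE] xy.
    by rewrite -xE -yE xy.
  move=> U mU Ub; rewrite img//; apply: measurableI; first exact: measurable_back.
  exact: mpre.
- move=> x [Yx _]; apply: Relation_Operators.rt_step; apply/(EY Yx).1; by exists i.
- by apply: measurableI; [exact: mpre|exact: measurable_back].
Qed.

Lemma integral_back i j (k : X -> \bar R) : measurable_fun setT k ->
  (forall x, 0 <= k x)%E ->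
  (\int[mu]_(x in back i j) k (phi i x) = \int[mu]_(x in back j i) k x)%E.
Proof.
move=> mk k0.
rewrite -(ge0_integral_mrestr _ (measurable_back i j)) //; last exact: measurableT_comp.
rewrite -(ge0_integral_mrestr _ (measurable_back j i)) //.
have := @ge0_integral_pushforward _ _ _ _ R (phi i) (mphi i)
  (mrestr mu (measurable_back i j)) setT k measurableT mk (fun x _ => k0 x).
rewrite preimage_setT => <-.
apply: eq_measure_integral => S mS _.
by rewrite /= /pushforward /mrestr measure_back.
Qed.

(** For [x] in [back i j], the edge labelled [i] at [x] is labelled [j] at its other end. After
    cutting [Y] into these pieces and changing variables along [phi i], the identity is an exchange
    of the two sums. *)
Lemma mass_transport (K : X -> X -> R) :
  (forall x y, 0 <= K x y) ->
  (forall i, measurable_fun setT (fun x => K x (phi i x))) ->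
  (forall i, measurable_fun setT (fun x => K (phi i x) x)) ->
  (\int[mu]_(x in Y) (\sum_i K x (phi i x))%:E =
   \int[mu]_(x in Y) (\sum_i K (phi i x) x)%:E)%E.
Proof.
move=> K0 mK mK'.
have sumE (L : 'I_D -> X -> R) : (forall i x, 0 <= L i x) ->
    (forall i, measurable_fun setT (L i)) ->
    (\int[mu]_(x in Y) (\sum_i L i x)%:E =
    \sum_i \sum_j \int[mu]_(x in back i j) (L i x)%:E)%E.
  move=> L0 mL; under eq_integral do rewrite -sumEFin.
  rewrite ge0_integral_sum//; last 2 first.
  - by move=> i; apply/measurable_EFinP; exact: measurable_funTS.
  - by move=> i x _; rewrite lee_fin.
  apply: eq_bigr => i _; rewrite {1}(bigcup_back i) ge0_integral_bigsetU//.
  - by rewrite big_enum.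
  - by move=> j; exact: measurable_back.
  - exact: enum_uniq.
  - by move=> j k _ _; exact: trivIset_back.
  - by apply/measurable_EFinP; exact: measurable_funTS.
  - by move=> x _; rewrite lee_fin.
rewrite sumE// sumE// exchange_big /=; apply: eq_bigr => j _; apply: eq_bigr => i _.
rewrite -(@integral_back i j (fun x => (K (phi j x) x)%:E)); last 2 first.
- by apply/measurable_EFinP.
- by move=> x; rewrite lee_fin.
by apply: eq_integral => x /set_mem[_ /= ->].
Qed.

End MassTransport.

(** * The space L2 *)

Section L2.
Context d (X : measurableType d) (R : realType) (mu : probability X R).

Lemma inL2P (f : X -> R) : inL2 mu f <-> f \in Lfun mu 2%:E.
Proof.
split=> [[mf fi]|fL].
  rewrite inE; apply/andP; split; rewrite inE//= /finite_norm unlock poweR_lty//.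
  apply: le_lt_trans fi; rewrite le_eqVlt; apply/orP; left; apply/eqP.
  by apply: eq_integral => x _ /=; rewrite powR_mulrn// real_normK ?num_real.
split.
  by move: fL; rewrite inE => /andP[/[!inE]].
by apply: integrable_lty => //; exact: Lfun2_integrable_sqr.
Qed.

Definition L2 := LfunType mu (lee1n 2 : (1 <= 2%:E :> \bar R)%E).

Definition mkL2 f (h : inL2 mu f) : L2 := Lfun_Sub (lee1n 2) ((inL2P f).1 h).

Lemma L2_inL2 (f : L2) : inL2 mu f.
Proof. by apply/inL2P; exact: LfunP. Qed.

Lemma L2_measurable (f : L2) : measurable_fun setT f.
Proof. by have [] := L2_inL2 f. Qed.

Lemma L2_mul_integrable (f g : L2) : mu.-integrable setT (fun x => (f x * g x)%:E).
Proof. by apply/Lfun1_integrable/Lfun2_mul_Lfun1; exact: LfunP. Qed.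

Definition dot (f g : L2) : R := \int[mu]_x (f x * g x).

Lemma dotE f g : (dot f g)%:E = (\int[mu]_x (f x * g x)%:E)%E.
Proof.
rewrite /dot /Rintegral fineK//; apply: integrable_fin_num => //.
exact: L2_mul_integrable.
Qed.

Lemma semi_inner_dot : semi_inner dot.
Proof.
split => [f g h|a f g|f g|f].
- rewrite /dot -RintegralD//; [|exact: L2_mul_integrable|exact: L2_mul_integrable].
  by apply: eq_Rintegral => x _; rewrite -mulrDl.
- rewrite /dot -RintegralZl//; last exact: L2_mul_integrable.
  by apply: eq_Rintegral => x _; rewrite mulrA.
- by apply: eq_Rintegral => x _; rewrite mulrC.
- by apply: Rintegral_ge0 => x _; rewrite -expr2 sqr_ge0.
Qed.

Let H := semi_inner_dot.
Local Notation nrm := (sn dot).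

Lemma inL2_cst c : inL2 mu (cst c : X -> R).
Proof. by apply: (@inL2_bounded _ _ _ mu (cst c) `|c|). Qed.

(** Cauchy-Schwarz against the constant 1, of norm one for a probability. *)
Lemma L2_normr_integral (f : L2) : (\int[mu]_x `|f x|%:E <= (nrm f)%:E)%E.
Proof.
have hf : inL2 mu (fun x => `|f x|).
  have [mf fi] := L2_inL2 f; split; first exact: measurableT_comp.
  by under eq_integral do rewrite real_normK ?num_real//.
have := abs_si_le H (mkL2 hf) (mkL2 (inL2_cst 1)).
have -> : nrm (mkL2 (inL2_cst 1)) = 1.
  rewrite /sn; suff -> : dot (mkL2 (inL2_cst 1)) (mkL2 (inL2_cst 1)) = 1 by rewrite sqrtr1.
  apply/EFin_inj; rewrite dotE /=; under eq_integral do rewrite mulr1.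
  by rewrite integral_cst// mul1e; exact: probability_setT.
have -> : nrm (mkL2 hf) = nrm f.
  by rewrite /sn; congr Num.sqrt; apply: eq_Rintegral => x _ /=; rewrite -normrM ger0_norm// -expr2 sqr_ge0.
rewrite mulr1 => h.
have := le_trans (ler_norm _) h; rewrite -lee_fin dotE.
by congr (_ <= _)%E; apply: eq_integral => x _ /=; rewrite mulr1.
Qed.

Lemma nrm_geometric (u : nat -> L2) C q : 0 <= q < 1 ->
  (forall n, nrm (u n.+1 - u n) <= C * q ^+ n) ->
  forall n k, nrm (u n - u (n + k)%N) <= C * q ^+ n / (1 - q).
Proof.
move=> /andP[q0 q1] uC n k.
have C0 : 0 <= C by have := uC 0%N; rewrite expr0 mulr1; apply: le_trans; exact: sn_ge0.
have key : nrm (u n - u (n + k)%N) <= C * q ^+ n * ((1 - q ^+ k) / (1 - q)).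
  elim: k => [|k IH].
    by rewrite addn0 !subrr mul0r mulr0 /sn si0l// sqrtr0.
  apply: (le_trans (sn_le_sum H _ (u (n + k)%N) _)).
  apply: (le_trans (lerD IH (_ : _ <= C * q ^+ (n + k)))).
    by rewrite snB// addnS; exact: uC.
  rewrite exprD mulrA -mulrDr ler_wpM2l ?mulr_ge0 ?exprn_ge0//.
  rewrite exprS le_eqVlt; apply/orP; left; apply/eqP; field.
  by rewrite subr_eq0 gt_eqF.
rewrite (le_trans key)// -!mulrA ler_wpM2l// ler_wpM2l ?exprn_ge0//.
by rewrite -[leRHS]mul1r ler_pM2r ?invr_gt0 ?subr_gt0// gerBl exprn_ge0.
Qed.

Lemma series_bounded_cvg (v : nat -> R) :
  (\sum_(0 <= k <oo) `|v k.+1 - v k|%:E < +oo)%E -> cvgn v.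
Proof.
move=> vfin.
have h : cvgn (series (telescope v)).
  apply: normed_cvg; apply: nondecreasing_is_cvgn.
    by apply: nondecreasing_series => k _ _; exact: normr_ge0.
  exists (fine (\sum_(0 <= k <oo) `|v k.+1 - v k|%:E)%E) => _ [n _ <-].
  rewrite -lee_fin fineK; last first.
    by rewrite ge0_fin_numE//; apply: nneseries_ge0 => k _ _; rewrite lee_fin.
  rewrite /series /= -sumEFin; apply: nneseries_lim_ge => k _ _.
  by rewrite lee_fin.
rewrite telescopeK in h.
have -> : v = (fun n => v n - v 0%N) + cst (v 0%N).
  by apply/funext => n; rewrite fctE subrK.
exact: is_cvgD h (is_cvg_cst _).
Qed.

(** The Riesz-Fischer argument: the increments are summable in L1, so the sequence converges off a
    null set, and Fatou's lemma bounds the L2 distance to the limit. *)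
Lemma geometrically_complete_dot : geometrically_complete dot.
Proof.
move=> u C q q01 uC; have unm := nrm_geometric q01 uC.
have /andP[q0 q1] := q01.
have C0 : 0 <= C by have := uC 0%N; rewrite expr0 mulr1; apply: le_trans; exact: sn_ge0.
pose s x := (\sum_(0 <= k <oo) `|u k.+1 x - u k x|%:E)%E.
have mdelta k : measurable_fun setT (fun x => `|u k.+1 x - u k x|%:E).
  apply/measurable_EFinP; apply: measurableT_comp => //.
  by apply: measurable_funB; exact: L2_measurable.
have ms : measurable_fun setT s.
  by apply: ge0_emeasurable_sum => k *; rewrite ?lee_fin//; exact: mdelta.
have s0 x : (0 <= s x)%E by apply: nneseries_ge0 => k _ _; rewrite lee_fin.
have ints : (\int[mu]_x s x < +oo)%E.
  rewrite /s integral_nneseries//.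
  apply: (@le_lt_trans _ _ (C / (1 - q))%:E); last exact: ltry.
  apply: lime_le; first by apply: is_cvg_nneseries => k _ _; apply: integral_ge0 => *; rewrite lee_fin.
  apply: nearW => n; apply: (@le_trans _ _ (\sum_(0 <= k < n) (C * q ^+ k)%:E)%E).
    apply: lee_sum => k _; apply: le_trans (_ : ((nrm (u k.+1 - u k))%:E <= _)%E).
      exact: (L2_normr_integral (u k.+1 - u k)).
    by rewrite lee_fin.
  rewrite sumEFin lee_fin; have := geometric_seriesE C (z := q).
  move=> /(_ (negbT (lt_eqF q1)))/(congr1 (fun f => f n)); rewrite /series /= => ->.
  rewrite ler_wpM2r ?invr_ge0 ?subr_ge0 ?(ltW q1)//.
  by rewrite ler_piMr// gerBl exprn_ge0.
pose G := [set x | (s x < +oo)%E].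
have mG : measurable G.
  have := emeasurable_fun_infty_o measurableT ms +oo%E; by rewrite setTI.
have G0 : mu (~` G) = 0%E.
  have /integrable_ae h : mu.-integrable setT s.
    apply/integrableP; split => //.
    by under eq_integral do rewrite gee0_abs//.
  apply/negligibleP; first exact: measurableC.
  apply: negligibleS (h measurableT) => x /= nG fx; apply: nG.
  by have := fx I; rewrite /G /= ge0_fin_numE.
(* The indicator makes the limit exist at every point, hence be measurable, and changes [u n] only
   on a null set. *)
pose v n x := \1_G x * u n x.
have cv x : cvgn (v ^~ x).
  have [Gx|Gx] := pselect (G x).
    apply: series_bounded_cvg; rewrite /v indicE mem_set//.
    by under eq_eseriesr do rewrite !mul1r.
  by rewrite /v indicE memNset//; under eq_fun do rewrite mul0r; exact: is_cvg_cst.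
pose l x := limn (v ^~ x).
have vl x : v ^~ x @ \oo --> l x by exact: cv.
have mv n : measurable_fun setT (v n).
  by apply: measurable_funM; [exact: measurable_indic|exact: L2_measurable].
have ml : measurable_fun setT l by exact: measurable_fun_cvg mv _.
have bound n : (\int[mu]_x ((u n x - l x) ^+ 2)%:E <= ((C * q ^+ n / (1 - q)) ^+ 2)%:E)%E.
  have meas (f : X -> R) : measurable_fun setT f ->
      measurable_fun setT (fun x => ((u n x - f x) ^+ 2)%:E).
    move=> mf; apply/measurable_EFinP; apply: measurable_funX.
    by apply: measurable_funB => //; exact: L2_measurable.
  pose f k x := ((u n x - u (n + k)%N x) ^+ 2)%:E.
  have mf k : measurable_fun setT (f k) by apply: meas; exact: L2_measurable.
  rewrite (@ge0_negligible_integral _ _ _ mu setT (~` G))//; last 3 first.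
  - exact: measurableC.
  - exact: meas.
  - by move=> x _; rewrite lee_fin sqr_ge0.
  rewrite setTD setCK.
  apply: (@le_trans _ _ (\int[mu]_(x in G) limn_einf (f ^~ x))%E).
    rewrite le_eqVlt; apply/orP; left; apply/eqP; apply: eq_integral => x /set_mem Gx.
    have fl : f ^~ x @ \oo --> ((u n x - l x) ^+ 2)%:E.
      apply: cvg_EFin; first exact: nearW.
      have ul : (fun k => u (n + k)%N x) @ \oo --> l x.
        have := vl x; rewrite -(cvg_shiftn n) /v indicE mem_set//.
        by under eq_fun do rewrite mul1r addnC.
      have -> : fine \o f ^~ x = (fun k => (u n x - u (n + k)%N x) * (u n x - u (n + k)%N x)).
        by apply/funext => k; rewrite /= expr2.
      rewrite expr2; apply: cvgM; apply: cvgB => //; exact: cvg_cst.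
    rewrite is_cvg_limn_einfE; last exact: cvgP fl.
    by apply/esym/cvg_lim.
  apply: (le_trans (fatou mu mG (fun k => measurable_funTS (mf k)) _)).
    by move=> k x _; rewrite lee_fin sqr_ge0.
  rewrite limn_einf_lim; apply: lime_le; first exact: is_cvg_einfs.
  apply: nearW => k; apply: le_trans (_ : (\int[mu]_x f k x <= _)%E).
    apply: (@le_trans _ _ (\int[mu]_(x in G) f k x)%E); first by apply: ereal_inf_lbound; exists k => /=.
    apply: ge0_subset_integral => //.
    by move=> x _; rewrite lee_fin sqr_ge0.
  have := unm n k; rewrite -(@ler_pXn2r _ 2) ?nnegrE ?sn_ge0//; last first.
    by rewrite divr_ge0 ?mulr_ge0 ?exprn_ge0// subr_ge0 ltW.
  by rewrite sn_sqr// -lee_fin dotE; under eq_integral do rewrite -expr2.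
have lL2 : inL2 mu l.
  split => //.
  have h : inL2 mu (fun x => u 0%N x - l x).
    split; first by apply: measurable_funB => //; exact: L2_measurable.
    exact: le_lt_trans (bound 0%N) (ltry _).
  have := L2_inL2 (u 0%N - mkL2 h) => -[_].
  by congr (_ < _)%E; apply: eq_integral => x _; rewrite /= opprB addrC subrK.
exists (mkL2 lL2) => n; rewrite -(@ler_pXn2r _ 2) ?nnegrE ?sn_ge0//; last first.
  by rewrite divr_ge0 ?mulr_ge0 ?exprn_ge0// subr_ge0 ltW.
rewrite sn_sqr// -lee_fin dotE (le_trans _ (bound n))//.
Qed.

Lemma dot_eq0P (f : L2) : dot f f = 0 <-> {ae mu, forall x, f x = 0}.
Proof.
have mff : measurable_fun setT (fun x => (f x * f x)%:E).
  by apply/measurable_EFinP; apply: measurable_funM; exact: L2_measurable.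
have E : (\int[mu]_x `|(f x * f x)%:E| = (dot f f)%:E)%E.
  by rewrite dotE; apply: eq_integral => x _; rewrite gee0_abs// lee_fin -expr2 sqr_ge0.
have [h1 h2] := ae_eq_integral_abs mu measurableT mff; split => [f0|f0].
  have := h1 (etrans E (congr1 EFin f0)); apply: filterS => x /(_ I) /= [] /eqP.
  by rewrite mulf_eq0 orbb => /eqP.
apply: EFin_inj; rewrite -E; apply: h2; apply: filterS f0 => x fx _ /=.
by rewrite fx mulr0.
Qed.

Lemma nrm_eq0P (f : L2) : nrm f = 0 <-> {ae mu, forall x, f x = 0}.
Proof.
rewrite -dot_eq0P /sn; split => [/eqP|->]; last by rewrite sqrtr0.
rewrite sqrtr_eq0 => f0; apply/eqP; rewrite eq_le f0; exact: (si_ge0 H).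
Qed.

End L2.

(** * The adjacency operator *)

Section Adjacency.
Context d (X : measurableType d) (R : realType) (mu : probability X R).
Variables (D : nat) (Y : set X) (phi : 'I_D -> X -> X).
Hypotheses (mY : measurable Y) (Y0 : mu (~` Y) = 0%E).
Hypothesis mphi : forall i, measurable_fun setT (phi i).
Hypothesis mass_transport : forall K : X -> X -> R,
  (forall x y, 0 <= K x y) ->
  (forall i, measurable_fun setT (fun x => K x (phi i x))) ->
  (forall i, measurable_fun setT (fun x => K (phi i x) x)) ->
  (\int[mu]_(x in Y) (\sum_i K x (phi i x))%:E =
   \int[mu]_(x in Y) (\sum_i K (phi i x) x)%:E)%E.

Local Notation L2 := (L2 mu).
Local Notation dot := (@dot _ _ _ mu).
Local Notation nrm := (sn dot).
Let H := semi_inner_dot mu.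

Lemma ge0_integral_conull (f : X -> R) : measurable_fun setT f -> (forall x, 0 <= f x) ->
  (\int[mu]_x (f x)%:E = \int[mu]_(x in Y) (f x)%:E)%E.
Proof.
move=> mf f0; rewrite (@ge0_negligible_integral _ _ _ mu setT (~` Y))//.
- by rewrite setTD setCK.
- exact: measurableC.
- exact/measurable_EFinP.
- by move=> x _; rewrite lee_fin.
Qed.

(** Outside [Y] the [phi i] are uncontrolled; the indicator removes these points, which form a null
    set. *)
Definition pull i (f : X -> R) x := \1_Y x * f (phi i x).

Lemma measurable_pull i f : measurable_fun setT f -> measurable_fun setT (pull i f).
Proof.
move=> mf; apply: measurable_funM; first exact: measurable_indic.
exact: measurableT_comp.
Qed.

Lemma pullE i f x : Y x -> pull i f x = f (phi i x).
Proof. by move=> Yx; rewrite /pull indicE mem_set// mul1r. Qed.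

(** Mass transport is stated for nonnegative kernels, so it is applied to the square
    [(f y + g x) ^+ 2]; symmetry of the adjacency operator follows by expanding. *)
Lemma pull_transport (f g : X -> R) : measurable_fun setT f -> measurable_fun setT g ->
  (\sum_i \int[mu]_x ((pull i f x + g x) ^+ 2)%:E =
   \sum_i \int[mu]_x ((f x + pull i g x) ^+ 2)%:E)%E.
Proof.
move=> mf mg.
have sumE (L M : 'I_D -> X -> R) : (forall i, measurable_fun setT (L i)) ->
    (forall i, measurable_fun setT (M i)) -> (forall i x, Y x -> L i x = M i x) ->
    (\sum_i \int[mu]_x ((L i x) ^+ 2)%:E = \int[mu]_(x in Y) (\sum_i (M i x) ^+ 2)%:E)%E.
  move=> mL mM LM; under [RHS]eq_integral do rewrite -sumEFin.
  rewrite ge0_integral_sum//; last 2 first.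
  - by move=> i; apply/measurable_EFinP/measurable_funTS; exact: measurable_funX.
  - by move=> i x _; rewrite lee_fin sqr_ge0.
  apply: eq_bigr => i _; rewrite ge0_integral_conull; last 2 first.
  - exact: measurable_funX.
  - by move=> x; rewrite sqr_ge0.
  by apply: eq_integral => x /set_mem Yx; rewrite LM.
have mfp i : measurable_fun setT (fun x => f (phi i x)) by exact: measurableT_comp.
have mgp i : measurable_fun setT (fun x => g (phi i x)) by exact: measurableT_comp.
rewrite (sumE (fun i x => pull i f x + g x) (fun i x => f (phi i x) + g x)); last 3 first.
- by move=> i; apply: measurable_funD => //; exact: measurable_pull.
- by move=> i; exact: measurable_funD.
- by move=> i x Yx /=; rewrite pullE.
rewrite (sumE (fun i x => f x + pull i g x) (fun i x => f x + g (phi i x))); last 3 first.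
- by move=> i; apply: measurable_funD => //; exact: measurable_pull.
- by move=> i; exact: measurable_funD.
- by move=> i x Yx /=; rewrite pullE.
apply: (mass_transport (K := fun x y => (f y + g x) ^+ 2)).
- by move=> x y; rewrite sqr_ge0.
- by move=> i; apply: measurable_funX; exact: measurable_funD.
- by move=> i; apply: measurable_funX; exact: measurable_funD.
Qed.

Lemma pull_sqr (f : X -> R) : measurable_fun setT f ->
  (\sum_i \int[mu]_x ((pull i f x) ^+ 2)%:E = \sum_(i < D) \int[mu]_x ((f x) ^+ 2)%:E)%E.
Proof.
move=> mf; have := pull_transport mf (measurable_cst (0 : R)).
under eq_bigr do under eq_integral do rewrite addr0.
move=> ->; apply: eq_bigr => i _; apply: eq_integral => x _.
by rewrite /pull mulr0 addr0.
Qed.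

Lemma pull_inL2 i (f : L2) : inL2 mu (pull i f).
Proof.
have [mf fi] := L2_inL2 f; split; first exact: measurable_pull.
apply: (@le_lt_trans _ _ (\sum_i \int[mu]_x ((pull i f x) ^+ 2)%:E)%E).
  rewrite (bigD1 i)//= leeDl// sume_ge0// => j _; apply: integral_ge0 => x _.
  by rewrite lee_fin sqr_ge0.
rewrite pull_sqr//; apply: lte_sum_pinfty => j _; exact: fi.
Qed.

Definition nbr i (f : L2) : L2 := mkL2 (pull_inL2 i f).

Definition adjL2 (f : L2) : L2 := \sum_i nbr i f.

Lemma nbrD i f g : nbr i (f + g) = nbr i f + nbr i g.
Proof. by apply/LfuneqP => x; rewrite /= /pull mulrDr. Qed.

Lemma nbrZ i a f : nbr i (a *: f) = a *: nbr i f.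
Proof. by apply/LfuneqP => x; rewrite /= /pull mulrCA. Qed.

Lemma sum_L2E (I : Type) (s : seq I) (F : I -> L2) x :
  (\sum_(i <- s) F i : L2) x = \sum_(i <- s) F i x.
Proof.
by elim: s => [|i s IH]; rewrite ?big_nil// !big_cons /= -IH.
Qed.

Lemma adjL2E f x : Y x -> adjL2 f x = \sum_i f (phi i x).
Proof. by move=> Yx; rewrite sum_L2E; apply: eq_bigr => i _; exact: pullE. Qed.

Lemma dot_suml (I : Type) (s : seq I) (F : I -> L2) g :
  dot (\sum_(i <- s) F i) g = \sum_(i <- s) dot (F i) g.
Proof.
elim: s => [|i s IH]; first by rewrite !big_nil si0l.
by rewrite !big_cons (siDl H) IH.
Qed.

Lemma nbr_transport (f g : L2) :
  \sum_i dot (nbr i f + g) (nbr i f + g) = \sum_i dot (f + nbr i g) (f + nbr i g).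
Proof.
apply: EFin_inj; rewrite -!sumEFin.
under eq_bigr do rewrite dotE; under [RHS]eq_bigr do rewrite dotE.
exact: (pull_transport (L2_measurable f) (L2_measurable g)).
Qed.

Lemma nbr_sqr (f : L2) : \sum_i dot (nbr i f) (nbr i f) = D%:R * dot f f.
Proof.
apply: EFin_inj; rewrite -sumEFin; under eq_bigr do rewrite dotE.
have := pull_sqr (L2_measurable f) => /= ->.
under eq_bigr do rewrite -[(\int[mu]_x _)%E]/(\int[mu]_x (f x * f x)%:E)%E -dotE.
by rewrite sumEFin sumr_const card_ord mulr_natl.
Qed.

(** The choices [g = - f] and [g = f] give the energies of [d - T] and [d + T]. *)
Lemma sum_nbr_sqr (f g : L2) : \sum_i dot (nbr i f + g) (nbr i f + g) =
  D%:R * dot f f + 2 * dot (adjL2 f) g + D%:R * dot g g.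
Proof.
rewrite -nbr_sqr dot_suml mulr_sumr.
have -> : D%:R * dot g g = \sum_(i < D) dot g g by rewrite sumr_const card_ord mulr_natl.
rewrite -!big_split /=; apply: eq_bigr => i _.
by rewrite !(siE H) (siC H g (nbr i f)); ring.
Qed.

Lemma adjL2_sym f g : dot (adjL2 f) g = dot f (adjL2 g).
Proof.
have := nbr_transport f g; rewrite sum_nbr_sqr.
under eq_bigr do rewrite addrC; rewrite sum_nbr_sqr (siC H (adjL2 g) f).
lra.
Qed.

Lemma sym_bounded_adjL2 : sym_bounded dot adjL2.
Proof.
split.
- by move=> f g; rewrite /adjL2 -big_split; apply: eq_bigr => i _; exact: nbrD.
- by move=> a f; rewrite /adjL2 scaler_sumr; apply: eq_bigr => i _; exact: nbrZ.
- exact: adjL2_sym.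
(* By [nbr_sqr] each of the [D] terms has norm at most [Num.sqrt D%:R * nrm f]. *)
- exists (D%:R * Num.sqrt D%:R) => [|f]; first by rewrite mulr_ge0 ?sqrtr_ge0.
  apply: (@le_trans _ _ (\sum_i nrm (nbr i f))).
    rewrite /adjL2; elim: (index_enum _) => [|i s IH].
      by rewrite !big_nil /sn si0l// sqrtr0.
    by rewrite !big_cons (le_trans (snD H _ _))// lerD2l.
  have -> : D%:R * Num.sqrt D%:R * nrm f = \sum_(i < D) Num.sqrt D%:R * nrm f.
    by rewrite sumr_const card_ord -mulrA mulr_natl.
  apply: ler_sum => i _; rewrite /sn -sqrtrM// ler_wsqrtr// -nbr_sqr.
  by rewrite (bigD1 i)//= lerDl sumr_ge0// => j _; exact: (si_ge0 H).
Qed.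

Definition laplacian (f : L2) : L2 := - (adjL2 f - D%:R *: f).

Lemma sym_bounded_laplacian : sym_bounded dot laplacian.
Proof. by apply: sym_boundedN => //; apply: sym_bounded_shift => //; exact: sym_bounded_adjL2. Qed.

Lemma laplacian_energy (f : L2) :
  \sum_i dot (nbr i f - f) (nbr i f - f) = 2 * dot (laplacian f) f.
Proof. by rewrite sum_nbr_sqr /laplacian !(siE H); ring. Qed.

Lemma signless_energy (f : L2) :
  \sum_i dot (nbr i f + f) (nbr i f + f) = 2 * dot (adjL2 f - (- D%:R) *: f) f.
Proof. by rewrite sum_nbr_sqr !(siE H); ring. Qed.

Lemma laplacian_ge0 f : 0 <= dot (laplacian f) f.
Proof.
have : 0 <= \sum_i dot (nbr i f - f) (nbr i f - f).
  by apply: sumr_ge0 => i _; exact: (si_ge0 H).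
by rewrite laplacian_energy pmulr_rge0.
Qed.

Lemma signless_ge0 f : 0 <= dot (adjL2 f - (- D%:R) *: f) f.
Proof.
have : 0 <= \sum_i dot (nbr i f + f) (nbr i f + f).
  by apply: sumr_ge0 => i _; exact: (si_ge0 H).
by rewrite signless_energy pmulr_rge0.
Qed.

(** Positivity of [d + T] gives [d - T <= 2 d]; the added 1 keeps the constant positive even when
    [D = 0]. *)
Lemma laplacian_le f : dot (laplacian f) f <= D.*2.+1%:R * dot f f.
Proof.
have := signless_ge0 f; rewrite /laplacian !(siE H) => h.
rewrite -addnn -addn1 !natrD; have := si_ge0 H f; lra.
Qed.

Lemma signless_le f : dot (adjL2 f - (- D%:R) *: f) f <= D.*2.+1%:R * dot f f.
Proof.
have := laplacian_ge0 f; rewrite /laplacian !(siE H) => h.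
rewrite -addnn -addn1 !natrD; have := si_ge0 H f; lra.
Qed.

(** The comparison holds edge by edge: the distance between [|s|] and [|t|] is at most [|s + t|]. *)
Lemma laplacian_abs_le (f h : L2) : (forall x, h x = `|f x|) ->
  dot (laplacian h) h <= dot (adjL2 f - (- D%:R) *: f) f.
Proof.
move=> hE; rewrite -(@ler_pM2l _ 2)// -laplacian_energy -signless_energy.
apply: ler_sum => i _; apply: le_Rintegral => //; try exact: L2_mul_integrable.
move=> x _.
have -> : (nbr i h - h) x = \1_Y x * h (phi i x) - h x by [].
have -> : (nbr i f + f) x = \1_Y x * f (phi i x) + f x by [].
rewrite !hE -!expr2 -[leLHS]real_normK ?num_real//.
rewrite -[leRHS]real_normK ?num_real// ler_pXn2r ?nnegrE//.
have := ler_dist_dist (\1_Y x * f (phi i x)) (- f x).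
by rewrite opprK normrN normrM indicE normr_nat.
Qed.

End Adjacency.

(** * The bipartition *)

Section ErgodicConst.
Context d (X : measurableType d) (R : realType) (mu : probability X R).

(** With [c] the mean of [l], the set where [l < c] is null or conull, so [l - c] has a constant
    sign almost everywhere; its integral being zero, it vanishes. *)
Lemma ae_eq_mean (l : X -> R) : mu.-integrable setT (EFin \o l) ->
  (forall c, mu [set x | l x < c] = 0%E \/ mu [set x | l x < c] = 1%E) ->
  exists c, {ae mu, forall x, l x = c}.
Proof.
move=> il l01; pose c := \int[mu]_x l x; exists c.
have ic : mu.-integrable setT (EFin \o cst c) by exact: finite_measure_integrable_cst.
have ml : measurable_fun setT l by apply/measurable_EFinP; case/integrableP: il.
have m1 : measurable [set x | l x < c].
  have /measurable_EFinP h := ml.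
  by have := emeasurable_fun_infty_o measurableT h c%:E; rewrite setTI.
have ilc : mu.-integrable setT (fun x => (l x - c)%:E).
  by have := integrableB measurableT il ic; apply: eq_integrable.
have mlc : measurable_fun setT (fun x => (l x - c)%:E) by case/integrableP: ilc.
have int0 : \int[mu]_x (l x - c) = 0.
  rewrite RintegralB// -/c Rintegral_cst//.
  apply/eqP; rewrite subr_eq0 -[eqbLHS]mulr1; apply/eqP; congr (_ * _).
  exact/esym/(congr1 fine (probability_setT mu)).
have int0' s : (\int[mu]_x (s * (l x - c))%:E = 0)%E.
  under eq_integral do rewrite EFinM.
  rewrite integralZl// (_ : (\int[mu]_x (l x - c)%:E = 0)%E) ?mule0//.
  by rewrite -[LHS]fineK ?integrable_fin_num//; congr EFin.
suff [s hs] : exists s, {ae mu, forall x, `|l x - c| = s * (l x - c)}.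
  have : (\int[mu]_x `|(l x - c)%:E| = 0)%E.
    rewrite -(int0' s); apply: ae_eq_integral => //.
    - exact: measurableT_comp.
    - by apply/measurable_EFinP; apply: measurable_funM => //; apply/measurable_EFinP.
    - by apply: filterS hs => x hx _ /=; rewrite hx.
  move=> /(ae_eq_integral_abs mu measurableT mlc); apply: filterS => x /(_ I) [] /eqP.
  by rewrite subr_eq0 => /eqP.
case: (l01 c) => l0.
  exists 1; exists [set x | l x < c]; split => // x /=; apply: contra_notP => /negP.
  by rewrite -leNgt mul1r => h; rewrite ger0_norm// subr_ge0.
exists (-1); exists (~` [set x | l x < c]); split; first exact: measurableC.
  by rewrite probability_setC// l0 subee.
move=> x /=; apply: contra_not => h; rewrite ler0_norm ?mulN1r//.
by rewrite subr_le0 ltW.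
Qed.

End ErgodicConst.

(** Zero energy makes [l] agree with its neighbours only almost everywhere. On a conull [Y'] closed
    under neighbours the agreement propagates along paths, so the part of [Y'] where [l < c] is
    closed under connectedness and ergodicity applies to it. *)
Lemma harmonic_ae_const d (X : measurableType d) (R : realType) (mu : probability X R)
    (E : set (X * X)) (D : nat) (Y : set X) (phi : 'I_D -> X -> X)
    (mY : measurable Y) (Y0 : mu (~` Y) = 0%E) (mphi : forall i, measurable_fun setT (phi i))
    (transport : forall K : X -> X -> R,
      (forall x y, 0 <= K x y) ->
      (forall i, measurable_fun setT (fun x => K x (phi i x))) ->
      (forall i, measurable_fun setT (fun x => K (phi i x) x)) ->
      (\int[mu]_(x in Y) (\sum_i K x (phi i x))%:E =
       \int[mu]_(x in Y) (\sum_i K (phi i x) x)%:E)%E)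
    (EY : forall x, Y x -> forall y, E (x, y) <-> exists i, y = phi i x)
    (inv : forall Z, measurable Z -> mu (~` Z) = 0%E -> exists Y', [/\ measurable Y',
      mu (~` Y') = 0%E, Y' `<=` Z & forall x, Y' x -> forall i, Y' (phi i x)])
    (erg : graph_ergodic mu E) (l : L2 mu) :
  sn (@dot _ _ _ mu) (laplacian mY Y0 mphi transport l) = 0 ->
  exists c, {ae mu, forall x, l x = c}.
Proof.
move=> lap0; have H := semi_inner_dot mu.
set nb := nbr mY Y0 mphi transport.
have e0 : \sum_i dot (nb i l - l) (nb i l - l) = 0.
  rewrite laplacian_energy; apply/eqP; rewrite mulf_eq0 pnatr_eq0/= -normr_eq0.
  by rewrite eq_le normr_ge0 andbT (le_trans (abs_si_le H _ _))// lap0 mul0r.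
have aei i : {ae mu, forall x, nb i l x - l x = 0}.
  suff /dot_eq0P : dot (nb i l - l) (nb i l - l) = 0 by [].
  move/eqP: e0; rewrite psumr_eq0; last by move=> j _; exact: (si_ge0 H).
  by move=> /allP/(_ i); rewrite mem_index_enum => /(_ isT)/eqP.
pose Z := Y `&` [set x | forall i, l (phi i x) - l x = 0].
have ml := L2_measurable l.
have mZ : measurable Z.
  apply: measurableI => //.
  rewrite (_ : [set x | _] = \bigcap_(i in setT) ((fun x => l (phi i x) - l x) @^-1` [set 0])).
    apply: fin_bigcap_measurable => //.
    move=> i _; rewrite -[X in measurable X]setTI.
    have : measurable_fun setT (fun x => l (phi i x) - l x).
      by apply: measurable_funB => //; exact: measurableT_comp.
    by apply.
  by apply/seteqP; split => x /= h i; [move=> _|]; exact: h.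
have Z0 : mu (~` Z) = 0%E.
  apply/negligibleP; first exact: measurableC.
  have aeY : {ae mu, forall x, Y x} by exists (~` Y); split => //; exact: measurableC.
  suff : {ae mu, forall x, Z x} by [].
  have aeA : {ae mu, forall x, forall i, nb i l x - l x = 0}.
    by apply: filter_forall => i; exact: aei.
  apply: filterS2 aeY aeA => x Yx h; split => // i.
  by have := h i; rewrite /= pullE.
have [Y' [mY' Y'0 Y'Z Y'phi]] := inv Z mZ Z0.
apply: ae_eq_mean.
  by apply/Lfun1_integrable; apply: Lfun_subset12; [exact: fin_num_measure|exact: LfunP].
move=> c; pose S := Y' `&` [set x | l x < c].
have mc : measurable [set x | l x < c].
  have /measurable_EFinP h := ml.
  by have := emeasurable_fun_infty_o measurableT h c%:E; rewrite setTI.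
have mS : measurable S by exact: measurableI.
have <- : mu S = mu [set x | l x < c].
  apply/eqP; rewrite eq_le le_measure ?inE//=; last exact: subIsetr.
  rewrite -[leRHS]adde0 -Y'0; have mY'C := measurableC mY'.
  apply: le_trans (measureU2 mu mS mY'C); apply: le_measure; rewrite ?inE//.
    exact: measurableU.
  by move=> x lx; have [Y'x|Y'x] := pselect (Y' x); [left|right].
apply: erg => // x y Sx xy; elim: xy Sx => [{}x {}y xy [Y'x lx]|//|{}x {}y z _ h1 _ h2 /h1/h2//].
have [Yx lphi] := Y'Z x Y'x; have [i ->] := (EY _ Yx y).1 xy; split; first exact: Y'phi.
by rewrite /=; have := lphi i => /eqP; rewrite subr_eq0 => /eqP ->.
Qed.

Section Bipartition.
Context d (X : measurableType d) (R : realType) (mu : probability X R).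
Variables (E : set (X * X)) (D : nat) (Y : set X) (phi : 'I_D -> X -> X).
Hypotheses (mY : measurable Y) (Y0 : mu (~` Y) = 0%E).
Hypothesis mphi : forall i, measurable_fun setT (phi i).
Hypothesis EY : forall x, Y x -> forall y, E (x, y) <-> exists i, y = phi i x.
Hypothesis transport : forall K : X -> X -> R,
  (forall x y, 0 <= K x y) ->
  (forall i, measurable_fun setT (fun x => K x (phi i x))) ->
  (forall i, measurable_fun setT (fun x => K (phi i x) x)) ->
  (\int[mu]_(x in Y) (\sum_i K x (phi i x))%:E =
   \int[mu]_(x in Y) (\sum_i K (phi i x) x)%:E)%E.
Local Notation dot := (@dot _ _ _ mu).
Local Notation adj := (adjL2 mY Y0 mphi transport).
Local Notation nb := (nbr mY Y0 mphi transport).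

Let H := semi_inner_dot mu.

Definition side (f : X -> R) := Y `&` [set x | 4^-1 < f x] `&`
  \bigcap_(i in setT) [set x | f (phi i x) <= 4^-1].

Lemma measurable_side f : measurable_fun setT f -> measurable (side f).
Proof.
move=> mf; have lt_m (g : X -> R) : measurable_fun setT g -> measurable [set x | 4^-1 < g x].
  move=> mg; have /measurable_EFinP h := mg.
  by have := emeasurable_fun_o_infty measurableT h (4^-1)%:E; rewrite setTI.
apply: measurableI; first by apply: measurableI => //; exact: lt_m.
apply: fin_bigcap_measurable => // i _.
rewrite (_ : [set x | _] = ~` [set x | 4^-1 < f (phi i x)]).
  by apply/measurableC/lt_m; exact: measurableT_comp.
by apply/seteqP; split => x /=; rewrite leNgt => /negP.
Qed.

Lemma independent_side f : independent_set E (side f).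
Proof.
move=> x y [[Yx _] fx] [[_ fy] _] Exy; have [i yE] := (EY Yx y).1 Exy.
by have := fx i I; rewrite /= -yE leNgt fy.
Qed.

(* A point [x] of [Y] outside both sides either has [`|f x| <= 1/4], and then
   [(h x - a) ^+ 2 >= 1/16], or a neighbour [y] on the same side, and then
   [(f x + f y) ^+ 2 >= 1/4]. *)
Lemma measure_sides (f h : L2 mu) (a : R) : (forall x, h x = `|f x|) -> 2^-1 <= a ->
  (mu (Y `\` (side f `|` side (fun x => (- f x)%R))) <=
    (16 * dot (h - mkL2 (inL2_cst mu a)) (h - mkL2 (inL2_cst mu a)) +
     8 * dot (adj f - (- D%:R) *: f) f)%:E)%E.
Proof.
move=> hE a2; set w := h - _; set S := side f `|` _.
have mf := L2_measurable f.
have mS : measurable (Y `\` S).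
  apply: measurableD => //; apply: measurableU; apply: measurable_side => //.
  exact: measurable_funN.
(* Chebyshev's inequality: the weights are the inverses of the bounds 1/16 and 1/4, so [g >= 1] on
   the bad set. The weight 4 turns into 8 because the sum over edges is twice the quadratic form. *)
pose g x := 16 * (w x * w x) + 4 * \sum_i (nb i f + f) x * (nb i f + f) x.
have sq_ge0 (y : R) : 0 <= y * y by rewrite -expr2 sqr_ge0.
have mw2 (u : L2 mu) : measurable_fun setT (fun x => u x * u x).
  by apply: measurable_funM; exact: L2_measurable.
have intg : (\int[mu]_x (g x)%:E = (16 * dot w w + 8 * dot (adj f - (- D%:R) *: f) f)%:E)%E.
  have -> : 8 * dot (adj f - (- D%:R) *: f) f = 4 * \sum_i dot (nb i f + f) (nb i f + f).
    by rewrite signless_energy; ring.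
  rewrite EFinD (EFinM 16) (EFinM 4) -sumEFin dotE; under eq_bigr do rewrite dotE.
  under eq_integral do rewrite EFinD (EFinM 16) (EFinM 4).
  rewrite ge0_integralD//; last 4 first.
  - by move=> x _; rewrite -EFinM lee_fin mulr_ge0.
  - by apply/measurable_EFinP; apply: measurable_funM => //; exact: mw2.
  - by move=> x _; rewrite -EFinM lee_fin mulr_ge0// sumr_ge0.
  - apply/measurable_EFinP; apply: measurable_funM => //.
    by apply: measurable_sum => i; exact: mw2.
  congr (_ + _)%E; rewrite ge0_integralZl//.
  - by apply/measurable_EFinP; exact: mw2.
  - by move=> x _; rewrite lee_fin.
  - congr (_ * _)%E; under eq_integral do rewrite -sumEFin.
    rewrite ge0_integral_sum//.
    + by move=> i; apply/measurable_EFinP; exact: mw2.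
    + by move=> i x _; rewrite lee_fin.
  - by apply/measurable_EFinP; apply: measurable_sum => i; exact: mw2.
  - by move=> x _; rewrite lee_fin sumr_ge0.
rewrite -intg -[mu _]mul1e -integral_cst//.
have mg : measurable_fun setT (fun x => (g x)%:E).
  apply/measurable_EFinP/measurable_funD.
    by apply: measurable_funM => //; exact: mw2.
  by apply: measurable_funM => //; apply: measurable_sum => i; exact: mw2.
have g0 x : 0 <= g x by rewrite addr_ge0// mulr_ge0// sumr_ge0.
apply: (@le_trans _ _ (\int[mu]_(x in Y `\` S) (g x)%:E)%E); last first.
  by apply: ge0_subset_integral => // x _; rewrite lee_fin.
apply: ge0_le_integral => //; first exact: measurable_funTS.
move=> x [Yx nS]; rewrite lee_fin.
have wE : w x = `|f x| - a by rewrite -hE.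
have nbE i : (nb i f + f) x = f (phi i x) + f x.
  by rewrite -[LHS]/(pull Y phi i f x + f x) pullE.
have edge i : (f (phi i x) + f x) * (f (phi i x) + f x) <=
    \sum_i (nb i f + f) x * (nb i f + f) x.
  by rewrite -nbE [leRHS](bigD1 i)// lerDl sumr_ge0.
have w0 := sq_ge0 (w x); have s0 : 0 <= \sum_i (nb i f + f) x * (nb i f + f) x by rewrite sumr_ge0.
have [fx|fx] := leP `|f x| 4^-1.
  have : 16^-1 <= w x * w x by rewrite wE; nra.
  by rewrite /g; lra.
suff [i hi] : exists i, 4^-1 <= (f (phi i x) + f x) * (f (phi i x) + f x).
  by have := edge i; rewrite /g; lra.
apply: contrapT => ni; apply: nS.
have [f0|f0] := leP 0 (f x).
  left; split; first by split => //=; rewrite -[ltRHS]ger0_norm.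
  move=> i _ /=; rewrite leNgt; apply/negP => hi; apply: ni; exists i.
  by rewrite ger0_norm// in fx; nra.
right; split; first by split => //=; rewrite -[ltRHS]ltr0_norm.
move=> i _ /=; rewrite leNgt; apply/negP => hi; apply: ni; exists i.
by rewrite ltr0_norm// in fx; nra.
Qed.

End Bipartition.

(** * Combining the gap at [d] with the spectrum at [-d] *)

Theorem theorem4p5 (dX : measure_display) (X : measurableType dX) (R : realType)
    (mu : probability X R) (E : set (X * X)) (d : nat) :
  @standard_borel dX X R ->
  borel_graph E ->
  d_regular mu E d ->
  graph_pmp mu E ->
  graph_ergodic mu E ->
  spectral_gap mu E d ->
  in_spectrum mu (adj_op E) (- d%:R) ->
  approx_measurably_bipartite mu E.
Proof.
move=> stdX [mE [Esym _]] reg pmp erg [eps [eps0 gap]] spec.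
have [A [phi [mA A0 mphi EA]]] := neighbor_selectors stdX mE reg.
have resolvent (lam : R) : d%:R - eps < lam -> lam != d%:R ->
    (forall f, inL2 mu f -> {ae mu, forall x, adj_op E f x - lam * f x = 0} ->
                {ae mu, forall x, f x = 0}) /\
    (forall g, inL2 mu g -> exists2 f, inL2 mu f &
                {ae mu, forall x, adj_op E f x - lam * f x = g x}).
  move=> lam1 lam2; apply: contrapT => /gap[/andP[_]|/eqP]; last by rewrite (negbTE lam2).
  by rewrite leNgt lam1.
have inj_res : forall f, inL2 mu f ->
    {ae mu, forall x, adj_op E f x - d.+1%:R * f x = 0} -> {ae mu, forall x, f x = 0 :> R}.
  by apply: (resolvent _ _ _).1; rewrite -addn1 natrD; [lra|rewrite -subr_eq0 addrC addKr oner_eq0].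
have inv := invariant_conull mA A0 mphi EA inj_res.
have [|Y [mY Y0 YA Yphi]] := inv setT measurableT; first by rewrite setCT measure0.
have EY' x (Yx : Y x) := EA x (YA x Yx).2.
have EY x (Yx : Y x) := (EY' x Yx).1.
have transport := mass_transport stdX Esym pmp mY mphi EY' Yphi.
have H := semi_inner_dot mu; have complete := @geometrically_complete_dot _ _ _ mu.
pose T := adjL2 mY Y0 mphi transport; pose L := laplacian mY Y0 mphi transport.
have sT : sym_bounded (@dot _ _ _ mu) T by exact: sym_bounded_adjL2.
have sL : sym_bounded (@dot _ _ _ mu) L by exact: sym_bounded_laplacian.
have aeY : {ae mu, forall x, Y x} by exists (~` Y); split => //; exact: measurableC.
have adjE (f : X -> R) (fL : inL2 mu f) : {ae mu, forall x, adj_op E f x = T (mkL2 fL) x}.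
  apply: filterS aeY => x Yx; have [Ex ix] := EY' x Yx.
  by rewrite (adj_opE Ex ix) /T adjL2E.
(* [L - lam] is the opposite of [T - (d - lam)], with [d - lam] strictly between [d - eps] and [d];
   hence the equation is solved for [- g]. *)
have surj lam : 0 < lam < eps -> surjective_mod (@dot _ _ _ mu) (fun u => L u - lam *: u).
  move=> /andP[lam0 lam1] g.
  have [||_ sg] := resolvent (d%:R - lam); [lra|by rewrite -subr_eq0; lra|].
  have [f fL fg] := sg _ (L2_inL2 (- g)); exists (mkL2 fL).
  apply/nrm_eq0P; apply: filterS2 (adjE _ fL) fg => x Tx fx.
  have -> : (L (mkL2 fL) - lam *: mkL2 fL - g) x =
    - (T (mkL2 fL) x - d%:R * f x) - lam * f x - g x by [].
  have {}fx : adj_op E f x - (d%:R - lam) * f x = - g x by [].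
  by rewrite -Tx; lra.
have C0 : 0 < d.*2.+1%:R :> R by [].
have gapL := gap_sqr_ge H complete sL eps0 (laplacian_ge0 mY Y0 mphi transport)
  (laplacian_le mY Y0 mphi transport) surj.
have [K K0 hK] := gap_projection H complete sL eps0 C0 (laplacian_ge0 mY Y0 mphi transport)
  (laplacian_le mY Y0 mphi transport) gapL.
(* Otherwise [T + d] would be coercive, hence injective by Cauchy-Schwarz and surjective by the
   Richardson iteration, and [-d] would not be in the spectrum. *)
have approx c : 0 < c -> exists f : L2 mu, dot (T f - (- d%:R) *: f) f < c * dot f f.
  move=> c0; apply: contrapT => nf; apply: spec.
  have coer f : c * dot f f <= dot (T f - (- d%:R) *: f) f.
    by rewrite leNgt; apply/negP => h; apply: nf; exists f.
  split=> [f fL fx|g gL].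
    suff /dot_eq0P : dot (mkL2 fL) (mkL2 fL) = 0 by [].
    have TE : sn (@dot _ _ _ mu) (T (mkL2 fL) - (- d%:R) *: mkL2 fL) = 0.
      apply/nrm_eq0P; apply: filterS2 (adjE _ fL) fx => x Tx fx.
      by rewrite -[LHS]/(T (mkL2 fL) x - (- d%:R) * f x) -Tx.
    have := coer (mkL2 fL); have := abs_si_le H (T (mkL2 fL) - (- d%:R) *: mkL2 fL) (mkL2 fL).
    rewrite TE mul0r normr_le0 => /eqP ->; rewrite pmulr_rle0// => h.
    by apply/eqP; rewrite eq_le h (si_ge0 H).
  have [f /nrm_eq0P fg] := coercive_surjective H complete (sym_bounded_shift H (- d%:R) sT)
    c0 C0 coer (signless_le mY Y0 mphi transport) (mkL2 gL).
  exists f; first exact: L2_inL2.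
  apply: filterS2 (adjE _ (L2_inL2 f)) fg => x Tx fx.
  have {}fx : T f x - (- d%:R) * f x - g x = 0 by [].
  have {}Tx : adj_op E f x = T f x by rewrite Tx; congr (T _ x); apply/LfuneqP.
  by rewrite Tx; lra.
move=> e e0.
have [delta delta0 [dK de]] : exists2 delta, 0 < delta &
    K ^+ 2 * delta <= 4^-1 /\ 16 * (K ^+ 2 * delta) + 8 * delta < e.
  have K2 : 0 < K ^+ 2 by rewrite exprn_gt0.
  (* [K ^+ 2 * delta] and [delta] add up to [m]. The bound [m <= 4^-1] will put [|f|] within 1/2 of
     a constant, and [16 * m <= e / 4] controls the bad set. *)
  pose m := Num.min (4^-1) (e / 64); pose delta := m / (K ^+ 2 + 1).
  have m0 : 0 < m by rewrite lt_min; apply/andP; split; lra.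
  have m1 : m <= 4^-1 by rewrite ge_min lexx.
  have m2 : m <= e / 64 by rewrite ge_min lexx orbT.
  have d0 : 0 < delta by rewrite divr_gt0//; lra.
  have dE : K ^+ 2 * delta + delta = m by rewrite /delta; field; rewrite gt_eqF//; lra.
  have Kd0 : 0 < K ^+ 2 * delta by rewrite mulr_gt0.
  by exists delta => //; split; lra.
have [f0 f0E] := approx delta delta0.
have f0n : 0 < dot f0 f0.
  rewrite lt_def (si_ge0 H) andbT; apply/eqP => f00.
  by move: f0E; rewrite f00 mulr0 ltNge signless_ge0.
pose f : L2 mu := (sn (@dot _ _ _ mu) f0)^-1 *: f0.
have ff : dot f f = 1.
  rewrite /f !(siE H) mulrA -expr2 exprVn (sn_sqr H) mulVf// gt_eqF//.
have fE : dot (T f - (- d%:R) *: f) f <= delta.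
  have sS := sym_bounded_shift H (- d%:R) sT.
  rewrite /f (sbZ sS (sn (@dot _ _ _ mu) f0)^-1 f0) !(siZl H) !(siZr H) mulrA -expr2 exprVn (sn_sqr H).
  by rewrite ler_pdivrMl// mulrC ltW.
have hL : inL2 mu (fun x => `|f x|).
  have [mf fi] := L2_inL2 f; split; first exact: measurableT_comp.
  by under eq_integral do rewrite real_normK ?num_real//.
pose h := mkL2 hL; have hE x : h x = `|f x| by [].
have [l Ll0 hl] := hK h.
have [c lc] := harmonic_ae_const EY
  (fun Z mZ Z0 => let: ex_intro Y' (And4 a b c e) := inv Z mZ Z0 in
     ex_intro _ Y' (And4 a b (fun x Yx => (c x Yx).1) e)) erg Ll0.
have {hl} hc : sn (@dot _ _ _ mu) (h - mkL2 (inL2_cst mu c)) <= K * Num.sqrt delta.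
  have -> : sn (@dot _ _ _ mu) (h - mkL2 (inL2_cst mu c)) = sn (@dot _ _ _ mu) (h - l).
    rewrite /sn; congr Num.sqrt; apply: EFin_inj; rewrite !dotE.
    have mm (u : L2 mu) : measurable_fun setT (fun x => (u x * u x)%:E).
      by apply/measurable_EFinP; apply: measurable_funM; exact: L2_measurable.
    apply: ae_eq_integral => //; try exact: mm.
    apply: filterS lc => x lx _.
    by rewrite -[(h - l) x]/(h x - l x) lx.
  rewrite (le_trans hl)// ler_pM2l// ler_wsqrtr//.
  exact: le_trans (laplacian_abs_le mY Y0 mphi transport hE) fE.
have hc2 : dot (h - mkL2 (inL2_cst mu c)) (h - mkL2 (inL2_cst mu c)) <= K ^+ 2 * delta.
  rewrite -(sn_sqr H) -[delta in leRHS]sqr_sqrtr ?(ltW delta0)// -exprMn.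
  by rewrite ler_pXn2r ?nnegrE ?sn_ge0 ?mulr_ge0 ?sqrtr_ge0// ltW.
have hh : dot h h = 1.
  by rewrite -ff; apply: eq_Rintegral => x _; rewrite hE -normrM ger0_norm// -expr2 sqr_ge0.
have cc : dot (mkL2 (inL2_cst mu c)) (mkL2 (inL2_cst mu c)) = c ^+ 2.
  apply: EFin_inj; rewrite dotE /= integral_cst// -[RHS]mule1 expr2; congr (_ * _)%E.
  exact: probability_setT.
(* [h] has norm 1 and lies within 1/2 of the constant [c]. *)
have c2 : 2^-1 <= `|c|.
  have : sn (@dot _ _ _ mu) h <= sn (@dot _ _ _ mu) (h - mkL2 (inL2_cst mu c)) +
      sn (@dot _ _ _ mu) (mkL2 (inL2_cst mu c)).
    by have := snD H (h - mkL2 (inL2_cst mu c)) (mkL2 (inL2_cst mu c)); rewrite subrK.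
  rewrite {1}/sn hh sqrtr1 [X in _ + X]/sn cc sqrtr_sqr.
  have : sn (@dot _ _ _ mu) (h - mkL2 (inL2_cst mu c)) <= 2^-1.
    rewrite -(@ler_pXn2r _ 2) ?nnegrE ?sn_ge0// (sn_sqr H).
    rewrite (le_trans hc2)// (le_trans dK)//; lra.
  lra.
(* The sign of [c] is unknown; since [h >= 0], replacing [c] by its absolute value does not increase
   the distance to [h]. *)
have hc3 : dot (h - mkL2 (inL2_cst mu `|c|)) (h - mkL2 (inL2_cst mu `|c|)) <= K ^+ 2 * delta.
  apply: le_trans hc2; apply: le_Rintegral => //; try exact: L2_mul_integrable.
  move=> x _; rewrite -!expr2.
  have -> : (h - mkL2 (inL2_cst mu `|c|)) x = `|f x| - `|c| by [].
  have -> : (h - mkL2 (inL2_cst mu c)) x = `|f x| - c by [].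
  rewrite -[leLHS]real_normK ?num_real// -[leRHS]real_normK ?num_real//.
  rewrite ler_pXn2r ?nnegrE//.
  by have := ler_dist_dist `|f x| c; rewrite normr_id.
have bad := measure_sides mY Y0 mphi transport hE c2.
pose S1 := side Y phi f; pose S2 := side Y phi (fun x => - f x).
have mS1 : measurable S1 by apply: measurable_side => //; exact: L2_measurable.
have mS2 : measurable S2.
  by apply: measurable_side => //; apply: measurable_funN; exact: L2_measurable.
exists S1, S2; split => //.
- apply/seteqP; split => // x [[[_ /= f1] _] [[_ /= f2] _]]; lra.
- exact: (independent_side EY).
- exact: (independent_side EY).
have mS := measurableU _ _ mS1 mS2.
have Sc : (mu (~` (S1 `|` S2)) < e%:E)%E.
  apply: (@le_lt_trans _ _ (mu (Y `\` (S1 `|` S2)) + mu (~` Y))%E).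
    have mYS := measurableD mY mS; have mYC := measurableC mY.
    apply: le_trans (measureU2 mu mYS mYC); apply: le_measure; rewrite ?inE//.
    + exact: measurableC.
    + exact: measurableU.
    + by move=> x nS; have [Yx|Yx] := pselect (Y x); [left|right].
  rewrite Y0 adde0 (le_lt_trans bad)// lte_fin (le_lt_trans _ de)//.
  by rewrite lerD// ler_pM2l.
have [r rE] : exists r, mu (S1 `|` S2) = r%:E.
  by exists (fine (mu (S1 `|` S2))); rewrite fineK// fin_num_measure.
have cE : mu (~` (S1 `|` S2)) = (1 - r)%:E by rewrite probability_setC// rE.
have {}Sc : 1 - r < e by move: Sc; rewrite cE lte_fin.
rewrite [X in (_ < X)%E](_ : _ = r%:E)// lte_fin; lra.
Qed.
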